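(* Let $X$ be a stable $\mathbb Z/4$-Godeaux surface with a single $\frac14(1,1)$ point $P$ and involution $\tau$, arising as the quotient $X=Y/\sigma$ for general $Y$ in $\mathcal Y^s$. The fixed curve of $\tau$ on $X$ is $R=C_1+C_2$, where the intersection $C_1\cap C_2$ is the singular point $P$. There are four isolated fixed points of $\tau$ on $X$.
   Context: We work over $\mathbb C$. A Godeaux surface is a minimal surface of general type (or its canonical model) with $p_g=q=0$, $K^2=1$; it is a $\mathbb Z/4$-Godeaux surface if $H^2(X,\mathbb Z)_{\mathrm{tors}}\cong\mathbb Z/4$. A stable $\mathbb Z/4$-Godeaux surface is a surface in the KSBA moduli space of these. $\mathcal Y$ denotes the family of complete intersections $Y=Y_{8,8}\subset\mathbb P(1,1,4,4,4)$, with coordinates $u_1,u_3,y_1,y_2,y_3$, defined by $q_0=q_2=0$, invariant under the (order $4$) automorphism $\sigma\colon(u_1,u_3,y_1,y_2,y_3)\mapsto(\varepsilon u_1,\varepsilon^3u_3,iy_1,y_2,-iy_3)$, $\varepsilon=\exp(2\pi i/8)$, where $q_0$ is a linear combination of $u_1^8,u_1^4u_3^4,u_3^8,u_1^3u_3y_1,u_1^2u_3^2y_2,u_1u_3^3y_3,y_2^2,y_1y_3$ and $q_2$ a linear combination of $u_1^6u_3^2,u_1^2u_3^6,u_1u_3^3y_1,u_1^4y_2,u_3^4y_2,u_1^3u_3y_3,y_1^2,y_3^2$. The general $Y$ has four $\frac14(1,1)$ singularities $Y\cap(u_1=u_3=0)$ forming a $\sigma$-orbit, $\sigma$ acts freely,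 and $X=Y/\sigma$ is a stable $\mathbb Z/4$-Godeaux surface with a single $\frac14(1,1)$ singularity. $\mathcal Y^s\subset\mathcal Y$ is the subfamily where $q_0$ is a linear combination of $u_1^8,u_1^4u_3^4,u_3^8,u_1^2u_3^2y_2,y_2^2,y_1y_3$ and $q_2$ a linear combination of $u_1^6u_3^2,u_1^2u_3^6,u_1^4y_2,u_3^4y_2,y_1^2,y_3^2$. Surfaces $Y$ in $\mathcal Y^s$ are invariant under $\tau\colon(u_1,u_3,y_1,y_2,y_3)\mapsto(iu_1,-iu_3,y_1,y_2,y_3)$, which induces an involution $\tau$ on $Y$ and on $X=Y/\sigma$. The fixed curve is the one-dimensional part of the fixed locus. *)

(* Defs.v *)
From HB Require Import structures.
From mathcomp Require Import ring.
From mathcomp Require Import all_boot all_order all_algebra.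
From mathcomp Require Import boolp classical_sets functions cardinality reals.
From mathcomp Require Import topology trigo.
From mathcomp Require Import generic_quotient complex mpoly.

Set Implicit Arguments.
Unset Strict Implicit.
Unset Printing Implicit Defensive.

Import Order.TTheory GRing.Theory Num.Theory.
Local Open Scope classical_set_scope.
Local Open Scope quotient_scope.
Local Open Scope ring_scope.

Definition irreducible_closed (T : topologicalType) (Z : set T) : Prop :=
  [/\ closed Z, Z !=set0 &
      forall A B : set T, closed A -> closed B ->
        Z `<=` A `|` B -> Z `<=` A \/ Z `<=` B].

Definition irreducible_component (T : topologicalType) (A Z : set T) : Prop :=
  [/\ irreducible_closed Z, Z `<=` A &
      forall W, irreducible_closed W -> Z `<=` W -> W `<=` A -> W = Z].

Definition irreducible_chain (T : topologicalType) (A : set T) (n : nat) :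
    Prop :=
  exists W : nat -> set T,
    (forall i, (i <= n)%N -> irreducible_closed (W i) /\ W i `<=` A) /\
    (forall i, (i < n)%N -> W i `<` W i.+1).

Definition has_dim (T : topologicalType) (A : set T) (n : nat) : Prop :=
  irreducible_chain A n /\ ~ irreducible_chain A n.+1.

Definition one_dimensional_part (T : topologicalType) (A : set T) : set T :=
  \bigcup_(Z in [set Z | irreducible_component A Z /\ has_dim Z 1]) Z.

Definition irreducible_curve (T : topologicalType) (Z : set T) : Prop :=
  irreducible_closed Z /\ has_dim Z 1.

(* Q holds on a nonempty Zariski open subset of affine n-space. *)
Definition for_general (R : realType) (n : nat) (Q : 'rV[R[i]]_n -> Prop) :
    Prop :=
  exists2 F : {mpoly R[i][n]}, F != 0 &
    forall c : 'rV[R[i]]_n, F.@[c 0] != 0 -> Q c.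

(* Representatives of points of P(1,1,4,4,4); the indices 0, 1, 2, 3, 4 stand
   for the coordinates u1, u3, y1, y2, y3. *)
Notation punctured R := {v : 'rV[R[i]]_5 | v != 0}.

Definition weight (j : 'I_5) : nat := nth 0%N [:: 1; 1; 4; 4; 4]%N j.

Definition torus (R : realType) (l : R[i]) : 'M[R[i]]_5 :=
  diag_mx (\row_j l ^+ weight j).

Definition wproj_rel (R : realType) (v w : punctured R) : bool :=
  `[< exists2 l : R[i], l != 0 & val w = val v *m torus l >].

Lemma torus1 (R : realType) : torus (1 : R[i]) = 1%:M.
Proof.
by apply/matrixP => i j; rewrite !mxE; case: eqP => // _; rewrite expr1n.
Qed.

Lemma torusM (R : realType) (k l : R[i]) : torus (k * l) = torus k *m torus l.
Proof.
by rewrite mulmx_diag; congr diag_mx; apply/rowP => j; rewrite !mxE exprMn.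
Qed.

Lemma wproj_rel_refl (R : realType) : reflexive (@wproj_rel R).
Proof.
by move=> v; apply/asboolP; exists 1; rewrite ?oner_eq0 ?torus1 ?mulmx1.
Qed.

Lemma wproj_rel_sym (R : realType) : ssrbool.symmetric (@wproj_rel R).
Proof.
move=> v w; apply/idP/idP => /asboolP [l l0 e]; apply/asboolP; exists l^-1;
  by rewrite ?invr_eq0 // e -mulmxA -torusM divff // torus1 mulmx1.
Qed.

Lemma wproj_rel_trans (R : realType) : transitive (@wproj_rel R).
Proof.
move=> w v x /asboolP [k k0 e] /asboolP [l l0 e']; apply/asboolP.
by exists (k * l); rewrite ?mulf_neq0 // e' e -mulmxA torusM.
Qed.

Canonical wproj_equiv (R : realType) := EquivRel (@wproj_rel R)
  (@wproj_rel_refl R) (@wproj_rel_sym R) (@wproj_rel_trans R).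

Definition wproj (R : realType) : Type := {eq_quot @wproj_rel R}.
HB.instance Definition _ (R : realType) := Choice.on (wproj R).
HB.instance Definition _ (R : realType) := Quotient.on (wproj R).
HB.instance Definition _ (R : realType) := EqQuotient.on (wproj R).

Definition coords (R : realType) (p : wproj R) : 'I_5 -> R[i] :=
  val (repr p) 0.

Definition whomog (R : realType) (f : {mpoly R[i][5]}) (d : nat) : Prop :=
  forall m, m \in msupp f -> (\sum_j m j * weight j)%N = d.

(* The sets f != 0, for f weighted homogeneous, are a basis of open sets;
   whether f vanishes at coords p does not depend on the representative. *)
Definition zariski_open (R : realType) (U : set (wproj R)) : Prop :=
  forall p, U p -> exists f d,
    [/\ whomog f d, f.@[coords p] != 0 &
        forall r : wproj R, f.@[coords r] != 0 -> U r].

Lemma zariski_openT (R : realType) : zariski_open [set: wproj R].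
Proof.
move=> p _; exists 1, 0%N; split=> //; last by rewrite meval1 oner_eq0.
move=> m; rewrite msupp1 inE => /eqP->.
by rewrite big1 // => j _; rewrite mnm0E.
Qed.

Lemma zariski_openI (R : realType) (U V : set (wproj R)) :
  zariski_open U -> zariski_open V -> zariski_open (U `&` V).
Proof.
move=> oU oV p [/oU [f [d [hf fp fU]]] /oV [g [e [hg gp gV]]]].
exists (f * g), (d + e)%N; split.
- move=> m /msuppM_le /allpairsP [[m1 m2] /= [i1 i2 ->]].
  rewrite -(hf _ i1) -(hg _ i2) -big_split /=.
  by apply: eq_bigr => j _; rewrite mnmDE mulnDl.
- by rewrite mevalM mulf_neq0.
- move=> r; rewrite mevalM mulf_eq0 negb_or => /andP[fr gr].
  by split; [exact: fU | exact: gV].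
Qed.

Lemma zariski_open_bigU (R : realType) (I : Type) (U : I -> set (wproj R)) :
  (forall i, zariski_open (U i)) -> zariski_open (\bigcup_i U i).
Proof.
move=> oU p [i _ /oU [f [d [hf fp fU]]]]; exists f, d; split=> // r fr.
by exists i => //; exact: fU.
Qed.

HB.instance Definition _ (R : realType) :=
  isOpenTopological.Build (wproj R) (@zariski_openT R) (@zariski_openI R)
    (@zariski_open_bigU R).

(* exp (2 pi i / 8) *)
Definition eps (R : realType) : R[i] :=
  Complex (cos (2 * trigo.pi / 8)) (sin (2 * trigo.pi / 8)).

Definition sigma_mx (R : realType) : 'M[R[i]]_5 :=
  diag_mx (\row_j [:: eps R; eps R ^+ 3; 'i%C; 1; - 'i%C]`_j).

Definition tau_mx (R : realType) : 'M[R[i]]_5 :=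
  diag_mx (\row_j [:: 'i%C; - 'i%C; 1; 1; 1]`_j).

(* Only meaningful for M invertible, otherwise val v *m M may vanish. *)
Definition act_vec (R : realType) (M : 'M[R[i]]_5) (v : punctured R) :
    punctured R :=
  insubd v (val v *m M).

Definition act (R : realType) (M : 'M[R[i]]_5) (p : wproj R) : wproj R :=
  \pi_(wproj R) (act_vec M (repr p)).

Definition sigma (R : realType) : wproj R -> wproj R := act (sigma_mx R).
Definition tau (R : realType) : wproj R -> wproj R := act (tau_mx R).

Lemma eps2 (R : realType) : eps R ^+ 2 = 'i%C.
Proof.
have pi2 : 2 * trigo.pi / 8 + 2 * trigo.pi / 8 = trigo.pi / 2 :> R by field.
have c2 := cosD (2 * trigo.pi / 8 : R) (2 * trigo.pi / 8).
have s2 := sinD (2 * trigo.pi / 8 : R) (2 * trigo.pi / 8).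
rewrite pi2 cos_pihalf in c2; rewrite pi2 sin_pihalf in s2.
by rewrite expr2 /eps /GRing.mul /= -c2 addrC -s2.
Qed.

Lemma sqr_Ci (R : realType) : 'i%C ^+ 2 = -1 :> R[i].
Proof. by apply/eqP; rewrite eq_complex /= !mul0r !mul1r oppr0 add0r addr0 !eqxx. Qed.

Lemma eps4 (R : realType) : eps R ^+ 4 = -1.
Proof. by rewrite (exprM _ 2 2) eps2 sqr_Ci. Qed.

Lemma sigma_mx4 (R : realType) : sigma_mx R ^+ 4 = torus (-1).
Proof.
have i4 : 'i%C ^+ 4 = 1 :> R[i] by rewrite (exprM _ 2 2) sqr_Ci sqrrN expr1n.
have pow4 (x : R[i]) : x * (x * (x * x)) = x ^+ 4 by rewrite !exprS expr0 mulr1.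
rewrite /sigma_mx -[diag_mx _ ^+ 4]/(_ *m (_ *m (_ *m _))) !mulmx_diag.
congr diag_mx; apply/rowP => j; rewrite !mxE pow4.
case: j => [[|[|[|[|[|j]]]]] jlt] //=; rewrite /weight /= ?expr1.
- exact: eps4.
- by rewrite -exprM (exprM _ 4 3) eps4 exprS sqrrN expr1n mulr1.
- by rewrite i4 -signr_odd.
- by rewrite expr1n -signr_odd.
- by rewrite -(mulN1r 'i%C) exprMn i4 mulr1.
Qed.

Lemma sigma_mx_unit (R : realType) : sigma_mx R \in unitmx.
Proof.
have t1 : torus (-1 : R[i]) *m torus (-1) = 1%:M.
  by rewrite -torusM mulN1r opprK torus1.
have /mulmx1_unit [tU _] := t1.
by rewrite -[_ \in _](unitrX_pos (sigma_mx R) (isT : (0 < 4)%N)) sigma_mx4.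
Qed.

Lemma tau_mx_unit (R : realType) : tau_mx R \in unitmx.
Proof.
have i0 : 'i%C != 0 :> R[i] by rewrite eq_complex /= oner_eq0 andbF.
rewrite unitmxE det_diag unitfE; apply/prodf_neq0 => j _; rewrite !mxE.
by case: j => [[|[|[|[|[|j]]]]] jlt] //=; rewrite ?oppr_eq0 ?oner_eq0.
Qed.

Lemma val_act_vec (R : realType) (M : 'M[R[i]]_5) (v : punctured R) :
  M \in unitmx -> val (act_vec M v) = val v *m M.
Proof.
move=> MU; rewrite /act_vec val_insubd ifT //; apply: contra_neq (valP v) => e.
by rewrite /= -(mulmxK MU (val v)) e mul0mx.
Qed.

Lemma wproj_eqP (R : realType) (v w : punctured R) :
  (exists2 l : R[i], l != 0 & val w = val v *m torus l) <->
  \pi_(wproj R) v = \pi_(wproj R) w.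
Proof.
split=> [e|/eqmodP/asboolP//]; apply/eqmodP; exact/asboolP.
Qed.

Lemma act_pi (R : realType) (d : 'rV[R[i]]_5) (v : punctured R) :
  diag_mx d \in unitmx ->
  act (diag_mx d) (\pi_(wproj R) v) = \pi_(wproj R) (act_vec (diag_mx d) v).
Proof.
move=> dU; have /wproj_eqP [l l0 e] := reprK (\pi_(wproj R) v).
apply/wproj_eqP; exists l => //; rewrite !val_act_vec // e.
by rewrite -!mulmxA; congr (_ *m _); exact: diag_mxC.
Qed.

Lemma act_comp (R : realType) (d e : 'rV[R[i]]_5) (p : wproj R) :
  diag_mx d \in unitmx -> diag_mx e \in unitmx ->
  act (diag_mx e) (act (diag_mx d) p) = act (diag_mx d *m diag_mx e) p.
Proof.
move=> dU eU; rewrite [act (diag_mx d) p]/act act_pi //; congr (\pi _).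
by apply: val_inj; rewrite !val_act_vec ?unitmx_mul ?dU // mulmxA.
Qed.

Lemma tau_sigma (R : realType) (p : wproj R) : tau (sigma p) = sigma (tau p).
Proof.
rewrite /tau /sigma !act_comp ?tau_mx_unit ?sigma_mx_unit //.
by congr (act _ p); exact: diag_mxC.
Qed.

Lemma torus_unit (R : realType) (l : R[i]) : l != 0 -> torus l \in unitmx.
Proof.
move=> l0; have /mulmx1_unit [] // : torus l *m torus l^-1 = 1%:M.
by rewrite -torusM divff ?torus1.
Qed.

Lemma act_torus (R : realType) (l : R[i]) (p : wproj R) :
  l != 0 -> act (torus l) p = p.
Proof.
move=> l0; rewrite -{2}[p]reprK; apply/esym/wproj_eqP; exists l => //.
by rewrite val_act_vec ?torus_unit.
Qed.

Lemma sigma4 (R : realType) (p : wproj R) : iter 4 (@sigma R) p = p.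
Proof.
rewrite /= /sigma (act_comp p) ?sigma_mx_unit // mulmx_diag.
rewrite (act_comp p) -?mulmx_diag ?unitmx_mul ?sigma_mx_unit // mulmx_diag.
rewrite mulmx_diag (act_comp p) -?mulmx_diag ?unitmx_mul ?sigma_mx_unit //.
rewrite -!mulmxA -[_ *m (_ *m (_ *m _))]/(sigma_mx R ^+ 4) sigma_mx4 act_torus //.
by rewrite oppr_eq0 oner_eq0.
Qed.

Lemma tau_invol (R : realType) : involutive (@tau R).
Proof.
move=> p; rewrite /tau act_comp ?tau_mx_unit //.
have -> : tau_mx R *m tau_mx R = torus (-1).
  rewrite mulmx_diag; congr diag_mx; apply/rowP => j; rewrite !mxE.
  case: j => [[|[|[|[|[|j]]]]] jlt] //=; rewrite /weight /= ?mulr1 //.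
  - by rewrite -expr2 sqr_Ci.
  - by rewrite mulrNN -expr2 sqr_Ci.
  - by rewrite -signr_odd.
  - by rewrite -signr_odd.
  - by rewrite -signr_odd.
by rewrite act_torus // oppr_eq0 oner_eq0.
Qed.

Definition sigma_rel (R : realType) (p q : wproj R) : bool :=
  `[< exists k : nat, q = iter k (@sigma R) p >].

Lemma iter_sigma4 (R : realType) (k : nat) (p : wproj R) :
  iter (4 * k) (@sigma R) p = p.
Proof.
by elim: k => [|k IH]; rewrite ?muln0 // mulnS iterD IH sigma4.
Qed.

Lemma sigma_rel_refl (R : realType) : reflexive (@sigma_rel R).
Proof. by move=> p; apply/asboolP; exists 0%N. Qed.

Lemma sigma_rel_sym (R : realType) : ssrbool.symmetric (@sigma_rel R).
Proof.
move=> p q; apply/idP/idP => /asboolP [k ->]; apply/asboolP;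
  by exists (3 * k)%N; rewrite -iterD -mulSnr iter_sigma4.
Qed.

Lemma sigma_rel_trans (R : realType) : transitive (@sigma_rel R).
Proof.
move=> q p r /asboolP [k ->] /asboolP [l ->]; apply/asboolP.
by exists (l + k)%N; rewrite iterD.
Qed.

Canonical sigma_equiv (R : realType) := EquivRel (@sigma_rel R)
  (@sigma_rel_refl R) (@sigma_rel_sym R) (@sigma_rel_trans R).

(* P(1,1,4,4,4) / <sigma> *)
Definition wprojS (R : realType) : Type :=
  quotient_topology {eq_quot @sigma_rel R}.
HB.instance Definition _ (R : realType) := Quotient.on (wprojS R).
HB.instance Definition _ (R : realType) := Topological.on (wprojS R).

Lemma wprojS_openE (R : realType) (U : set (wprojS R)) :
  open U = zariski_open (\pi_(wprojS R) @^-1` U).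
Proof. by []. Qed.

Definition tauS (R : realType) (x : wprojS R) : wprojS R :=
  \pi_(wprojS R) (tau (repr x)).

Lemma wprojS_eqP (R : realType) (p q : wproj R) :
  (exists k : nat, q = iter k (@sigma R) p) <->
  \pi_(wprojS R) p = \pi_(wprojS R) q.
Proof.
have eqP := eqmodP (sigma_equiv R) p q.
split=> [e|e]; first by apply: (elimT eqP); exact/asboolP.
by apply/asboolP; exact: (introT eqP).
Qed.

Lemma tauS_pi (R : realType) (p : wproj R) :
  tauS (\pi_(wprojS R) p) = \pi_(wprojS R) (tau p).
Proof.
have /wprojS_eqP [k e] := reprK (\pi_(wprojS R) p).
apply/wprojS_eqP; exists k; move: (repr _) e => r ->.
by elim: k => //= k <-; rewrite tau_sigma.
Qed.

Lemma tauS_invol (R : realType) : involutive (@tauS R).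
Proof. by move=> x; rewrite {2}/tauS tauS_pi tau_invol reprK. Qed.

Definition u1 (R : realType) : {mpoly R[i][5]} := 'X_(0 : 'I_5).
Definition u3 (R : realType) : {mpoly R[i][5]} := 'X_(1 : 'I_5).
Definition y1 (R : realType) : {mpoly R[i][5]} := 'X_(2 : 'I_5).
Definition y2 (R : realType) : {mpoly R[i][5]} := 'X_(3 : 'I_5).
Definition y3 (R : realType) : {mpoly R[i][5]} := 'X_(4 : 'I_5).

Definition q0 (R : realType) (a : 'rV[R[i]]_6) : {mpoly R[i][5]} :=
  a 0 0 *: u1 R ^+ 8 + a 0 1 *: (u1 R ^+ 4 * u3 R ^+ 4) + a 0 2 *: u3 R ^+ 8
  + a 0 3 *: (u1 R ^+ 2 * u3 R ^+ 2 * y2 R) + a 0 4 *: y2 R ^+ 2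
  + a 0 5 *: (y1 R * y3 R).

Definition q2 (R : realType) (b : 'rV[R[i]]_6) : {mpoly R[i][5]} :=
  b 0 0 *: (u1 R ^+ 6 * u3 R ^+ 2) + b 0 1 *: (u1 R ^+ 2 * u3 R ^+ 6)
  + b 0 2 *: (u1 R ^+ 4 * y2 R) + b 0 3 *: (u3 R ^+ 4 * y2 R)
  + b 0 4 *: y1 R ^+ 2 + b 0 5 *: y3 R ^+ 2.

Definition surfY (R : realType) (a b : 'rV[R[i]]_6) : set (wproj R) :=
  [set p | (q0 a).@[coords p] = 0 /\ (q2 b).@[coords p] = 0].

(* Y is sigma-invariant and the quotient map is closed, so Y / sigma is the
   image of Y, with the subspace topology. *)
Definition surfX (R : realType) (a b : 'rV[R[i]]_6) : set (wprojS R) :=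
  \pi_(wprojS R) @` surfY a b.

Lemma meval_exp (R : realType) (w : 'I_5 -> R[i]) (f : {mpoly R[i][5]}) n :
  (f ^+ n).@[w] = f.@[w] ^+ n.
Proof. by elim: n => [|n IH]; rewrite ?expr0 ?meval1 // !exprS mevalM IH. Qed.

Lemma meval_mon (R : realType) (w : 'I_5 -> R[i]) (c : R[i]) (j k : 'I_5) m n :
  (c *: ('X_j ^+ m * 'X_k ^+ n)).@[w] = c * (w j ^+ m * w k ^+ n).
Proof. by rewrite mevalZ mevalM !meval_exp !mevalXU. Qed.

Lemma meval_mon1 (R : realType) (w : 'I_5 -> R[i]) (c : R[i]) (j : 'I_5) n :
  (c *: 'X_j ^+ n).@[w] = c * w j ^+ n.
Proof. by rewrite mevalZ meval_exp mevalXU. Qed.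

Lemma meval_mon2 (R : realType) (w : 'I_5 -> R[i]) (c : R[i]) (j k : 'I_5) m :
  (c *: ('X_j ^+ m * 'X_k)).@[w] = c * (w j ^+ m * w k).
Proof. by rewrite mevalZ mevalM meval_exp !mevalXU. Qed.

Lemma meval_mon3 (R : realType) (w : 'I_5 -> R[i]) (c : R[i]) (j k : 'I_5) :
  (c *: ('X_j * 'X_k)).@[w] = c * (w j * w k).
Proof. by rewrite mevalZ mevalM !mevalXU. Qed.

Lemma meval_mon4 (R : realType) (w : 'I_5 -> R[i]) (c : R[i]) (i j k : 'I_5)
    m n :
  (c *: ('X_i ^+ m * 'X_j ^+ n * 'X_k)).@[w] = c * (w i ^+ m * w j ^+ n * w k).
Proof. by rewrite mevalZ !mevalM !meval_exp !mevalXU. Qed.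

Lemma meval_sum6 (R : realType) (w : 'I_5 -> R[i])
    (A B C D E F : {mpoly R[i][5]}) :
  (A + B + C + D + E + F).@[w] =
  A.@[w] + B.@[w] + C.@[w] + D.@[w] + E.@[w] + F.@[w].
Proof. by rewrite !mevalD. Qed.

Lemma q0E (R : realType) (a : 'rV[R[i]]_6) (w : 'I_5 -> R[i]) :
  (q0 a).@[w] = a 0 0 * w 0 ^+ 8 + a 0 1 * (w 0 ^+ 4 * w 1 ^+ 4)
    + a 0 2 * w 1 ^+ 8 + a 0 3 * (w 0 ^+ 2 * w 1 ^+ 2 * w 3)
    + a 0 4 * w 3 ^+ 2 + a 0 5 * (w 2 * w 4).
Proof.
rewrite /q0 meval_sum6.
congr (_ + _ + _ + _ + _ + _);
  [exact: meval_mon1|exact: meval_mon|exact: meval_mon1|exact: meval_mon4|exact: meval_mon1|exact: meval_mon3].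
Qed.

Lemma q2E (R : realType) (b : 'rV[R[i]]_6) (w : 'I_5 -> R[i]) :
  (q2 b).@[w] = b 0 0 * (w 0 ^+ 6 * w 1 ^+ 2) + b 0 1 * (w 0 ^+ 2 * w 1 ^+ 6)
    + b 0 2 * (w 0 ^+ 4 * w 3) + b 0 3 * (w 1 ^+ 4 * w 3)
    + b 0 4 * w 2 ^+ 2 + b 0 5 * w 4 ^+ 2.
Proof.
rewrite /q2 meval_sum6.
congr (_ + _ + _ + _ + _ + _);
  [exact: meval_mon|exact: meval_mon|exact: meval_mon2|exact: meval_mon2|exact: meval_mon1|exact: meval_mon1].
Qed.

Lemma mulmx_diagE (R : realType) (v d : 'rV[R[i]]_5) (j : 'I_5) :
  (v *m diag_mx d) 0 j = v 0 j * d 0 j.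
Proof. by rewrite mul_mx_diag mxE. Qed.

Lemma and_iff (A B C D : Prop) : (A <-> C) -> (B <-> D) -> A /\ B <-> C /\ D.
Proof. by move=> [AC CA] [BD DB]; split=> -[]; split; auto. Qed.

Lemma eq0_iff (R : realType) (x y : R[i]) : x = y -> x = 0 <-> y = 0.
Proof. by move=> ->. Qed.

Lemma surfY_pi (R : realType) (a b : 'rV[R[i]]_6) (v : punctured R) :
  surfY a b (\pi_(wproj R) v) <->
  (q0 a).@[val v 0] = 0 /\ (q2 b).@[val v 0] = 0.
Proof.
have /wproj_eqP [l l0 e] := reprK (\pi_(wproj R) v).
have h0 : (q0 a).@[val v 0] = l ^+ 8 * (q0 a).@[coords (\pi_(wproj R) v)].
  by rewrite e /coords !q0E !mulmx_diagE !mxE /weight /=; ring.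
have h2 : (q2 b).@[val v 0] = l ^+ 8 * (q2 b).@[coords (\pi_(wproj R) v)].
  by rewrite e /coords !q2E !mulmx_diagE !mxE /weight /=; ring.
have k (x y : R[i]) : y = l ^+ 8 * x -> x = 0 <-> y = 0.
  move=> ->; split=> [->|/eqP]; first by rewrite mulr0.
  by rewrite mulf_eq0 expf_eq0 /= (negbTE l0) => /eqP.
exact: (and_iff (k _ _ h0) (k _ _ h2)).
Qed.

Lemma surfY_sigma (R : realType) (a b : 'rV[R[i]]_6) (p : wproj R) :
  surfY a b (sigma p) <-> surfY a b p.
Proof.
have e4 := eps4 R; have i2 := sqr_Ci R.
have h0 : (q0 a).@[(val (repr p) *m sigma_mx R) 0] = (q0 a).@[coords p].
  by rewrite /coords !q0E !mulmx_diagE !mxE /=; ring: e4 i2.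
have h2 : (q2 b).@[(val (repr p) *m sigma_mx R) 0] = - (q2 b).@[coords p].
  by rewrite /coords !q2E !mulmx_diagE !mxE /=; ring: e4 i2.
have ev := val_act_vec (repr p) (sigma_mx_unit R).
have g0 := etrans (congr1 (fun w : 'rV_5 => (q0 a).@[w 0]) ev) h0.
have g2 := etrans (congr1 (fun w : 'rV_5 => (q2 b).@[w 0]) ev) h2.
have opp0 (x y : R[i]) : y = - x -> y = 0 <-> x = 0.
  move=> ->; split=> [/eqP|->]; last by rewrite oppr0.
  by rewrite oppr_eq0 => /eqP.
exact: (iff_trans (surfY_pi a b _) (and_iff (eq0_iff g0) (opp0 _ _ g2))).
Qed.

Lemma surfY_tau (R : realType) (a b : 'rV[R[i]]_6) (p : wproj R) :
  surfY a b (tau p) <-> surfY a b p.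
Proof.
have i2 := sqr_Ci R.
have h0 : (q0 a).@[(val (repr p) *m tau_mx R) 0] = (q0 a).@[coords p].
  by rewrite /coords !q0E !mulmx_diagE !mxE /=; ring: i2.
have h2 : (q2 b).@[(val (repr p) *m tau_mx R) 0] = (q2 b).@[coords p].
  by rewrite /coords !q2E !mulmx_diagE !mxE /=; ring: i2.
have ev := val_act_vec (repr p) (tau_mx_unit R).
have g0 := etrans (congr1 (fun w : 'rV_5 => (q0 a).@[w 0]) ev) h0.
have g2 := etrans (congr1 (fun w : 'rV_5 => (q2 b).@[w 0]) ev) h2.
exact: (iff_trans (surfY_pi a b _) (and_iff (eq0_iff g0) (eq0_iff g2))).
Qed.

Lemma tauS_surfX (R : realType) (a b : 'rV[R[i]]_6) (x : wprojS R) :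
  surfX a b x -> surfX a b (tauS x).
Proof.
by move=> [p pY <-]; exists (tau p); [exact/surfY_tau | rewrite tauS_pi].
Qed.

Definition fixed_locus (R : realType) (a b : 'rV[R[i]]_6) : set (wprojS R) :=
  [set x | surfX a b x /\ tauS x = x].

Definition jacobian (R : realType) (a b : 'rV[R[i]]_6) (v : 'rV[R[i]]_5) :
    'M[R[i]]_(5, 2) :=
  \matrix_(j, k) (if k == 0 then q0 a else q2 b)^`M(j).@[v 0].

Definition euler (R : realType) (v : 'rV[R[i]]_5) : 'rV[R[i]]_5 :=
  \row_j ((weight j)%:R * v 0 j).

Definition stabilizer (R : realType) (v : 'rV[R[i]]_5) : set 'M[R[i]]_5 :=
  [set g | (exists l k, l != 0 /\ g = torus l *m sigma_mx R ^+ k) /\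
           v *m g = v].

(* x is a 1/4(1,1) singularity: the affine cone over Y is smooth of dimension 3
   at v, so that near x the surface X is the quotient of a slice to the orbit
   of v, under the group generated by the torus and sigma, by the stabilizer of
   v. The tangent plane to the slice is the tangent space of the cone modulo the
   tangent line to the orbit, spanned by euler v; the stabilizer must be mu_4,
   acting on this plane by scalar multiplication. *)
Definition quarter_point (R : realType) (a b : 'rV[R[i]]_6) (x : wprojS R) :
    Prop :=
  surfX a b x /\
  exists v : punctured R,
    [/\ \pi_(wprojS R) (\pi_(wproj R) v) = x,
        \rank (jacobian a b (val v)) = 2%N &
        exists chi : 'M[R[i]]_5 -> R[i],
          set_bij (stabilizer (val v)) [set z | z ^+ 4 = 1] chi /\
          forall g, stabilizer (val v) g ->
            forall t : 'rV[R[i]]_5, t *m jacobian a b (val v) = 0 ->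
              exists s : R[i], t *m g = chi g *: t + s *: euler (val v)].

(* Main.v *)
Require Import Defs.
From HB Require Import structures.
From mathcomp Require Import all_boot all_order all_algebra.
From mathcomp Require Import boolp classical_sets functions cardinality reals.
From mathcomp Require Import topology trigo.
From mathcomp Require Import generic_quotient complex mpoly.
From mathcomp Require Import separable ring.

Set Implicit Arguments.
Unset Strict Implicit.
Unset Printing Implicit Defensive.

Import Order.TTheory GRing.Theory Num.Theory.
Local Open Scope classical_set_scope.
Local Open Scope quotient_scope.
Local Open Scope ring_scope.

(** Write Y for the complete intersection q0 = q2 = 0 and X = Y / sigma.  The
    involution of X fixes the class of p in Y exactly when tau p = sigma^k p for
    some k.  Comparing coordinates, this forces u3 = 0, or u1 = 0, or
    y1 = y3 = 0 ([fixed_locusE]), so the fixed locus is the union of the images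
    C1, C2 of the two curves u3 = 0 and u1 = 0 in Y, and of the image of the
    finite set y1 = y3 = 0.

    Each of the two curves is an intersection of two quadrics in the
    coordinates t = u^4, y1, y2, y3.  For suitable linear forms P, M in y1, y3
    its equations become P^2 = A(t, y2), M^2 = B(t, y2), with A and B binary
    quadratic forms without multiple or common roots.  In a chart, a polynomial
    function on it is a + b P + c M + d P M with a, b, c, d polynomials in one
    variable s, and its zeros lie over the roots of its norm.  Since A, B and
    AB are not squares, the norm is zero only for a = b = c = d = 0
    ([biquadratic_zeros]).  Hence a closed set contains the whole curve or
    only finitely many of its points ([curve_dichotomy]), and this dichotomy
    gives irreducibility and dimension one by pure topology, for the
    curve and its image in X.

    The curves C1 and C2 meet over u1 = u3 = 0.  There Y has four points,
    permuted simply transitively by sigma, so they give one point P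
    ([fixed_curvesI]).  The stabilizer of a vector over P is the group of
    scalars l with l^4 = 1, acting by l on the (u1, u3)-plane, which is the
    tangent plane of the slice.  A vector with u1 or u3 nonzero has fewer than
    four stabilizing elements, so P is the only 1/4(1,1) point
    ([quarter_points]).

    On y1 = y3 = 0, eliminating y2 leaves a binary quartic in (u1^4 : u3^4),
    and sigma acts transitively on the points of Y over each root.  When the
    discriminant is nonzero there are four roots, so four points of X; they lie
    off C1 and C2 and are therefore the isolated points ([residual_card]).  All
    the nondegeneracy conditions are collected in the polynomial
    [generic_form]. *)

(** * Closed sets whose proper closed subsets are finite *)

Section FiniteClosed.
Variable T : topologicalType.
Hypothesis T1 : accessible_space T.

Let finite_closed (A : set T) : finite_set A -> closed A.
Proof. by have [h _] := @accessible_finite_set_closed T; exact: h. Qed.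

(** A point of W and the rest of W are both closed. *)
Lemma finite_irreducible (W : set T) :
  finite_set W -> irreducible_closed W -> exists x, W = [set x].
Proof.
move=> finW [_ [x Wx] irrW]; exists x; apply/seteqP; split=> [|_ ->//].
have cx : closed [set x] by exact: accessible_closed_set1.
have cW : closed (W `\ x).
  by apply: finite_closed; apply: finite_setD.
have cover : W `<=` [set x] `|` W `\ x.
  by move=> y Wy; have [->|yx] := pselect (y = x); [left | right].
by have [//|sub] := irrW _ _ cx cW cover; have [_ []] := sub _ Wx.
Qed.

Lemma finite_has_dim1N (W : set T) :
  finite_set W -> irreducible_closed W -> ~ has_dim W 1.
Proof.
move=> finW /(finite_irreducible finW)[x ->] [[Z [irrZ ltZ]] _].
have [sub ne] := ltZ 0%N isT; apply: ne.
have [[_ [z Zz] _] _] := irrZ 0%N isT.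
have [_ Z1] := irrZ 1%N isT.
by move=> y /Z1 ->; rewrite -(Z1 _ (sub _ Zz)).
Qed.

(** A topological substitute for an irreducible curve: it can be verified by
    counting zeros of polynomials, and passes to finite quotients. *)
Definition cofinite_curve (C : set T) : Prop :=
  [/\ closed C, infinite_set C &
      forall K, closed K -> C `<=` K \/ finite_set (C `&` K)].

Lemma cofinite_irreducible (C : set T) :
  cofinite_curve C -> irreducible_closed C.
Proof.
move=> [cC infC dich]; split=> //; first exact: infinite_setN0.
move=> A B cA cB CAB.
have [|finA] := dich A cA; first by left.
have [|finB] := dich B cB; first by right.
case: infC.
apply: (sub_finite_set _ (_ : finite_set (C `&` A `|` C `&` B))).
- by rewrite -setIUr => x Cx; split=> //; exact: CAB.
- by rewrite finite_setU.
Qed.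

(** The middle term of a chain of length two would be finite and irreducible,
    hence a point, with no room for a smaller nonempty term. *)
Lemma cofinite_has_dim1 (C : set T) : cofinite_curve C -> has_dim C 1.
Proof.
move=> curveC; have irrC := cofinite_irreducible curveC.
have [cC infC dich] := curveC; split.
- have [_ [x Cx] _] := irrC.
  exists (fun n => if n == 0%N then [set x] else C); split=> [[|i] _|[|i]//= _].
  + split=> /=; last by move=> _ ->.
    split; [exact: accessible_closed_set1 | by exists x |].
    move=> A B _ _ /(_ x erefl)[Ax|Bx]; [left|right]; by move=> _ ->.
  + by split.
  + split; first by move=> _ ->.
    by move=> sub; apply: infC; exact: (sub_finite_set sub (finite_set1 x)).
- move=> [W [irrW ltW]].
  have [W0 _] := irrW 0%N isT; have [W1 W1C] := irrW 1%N isT.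
  have [_ W2C] := irrW 2%N isT.
  have [W01 nW10] := ltW 0%N isT; have [W12 nW21] := ltW 1%N isT.
  have [clW1 _ _] := W1.
  have [CW1|finW1] := dich _ clW1.
    by apply: nW21 => x /W2C /CW1.
  rewrite setIidr // in finW1.
  have [x eW1] := finite_irreducible finW1 W1; apply: nW10.
  have [_ [y W0y] _] := W0.
  have := W01 _ W0y; rewrite eW1 => yx _ ->.
  by rewrite -yx.
Qed.

Section TwoCurvesAndPoints.
Variables C1 C2 F : set T.
Hypotheses (curve1 : cofinite_curve C1) (curve2 : cofinite_curve C2).
Hypothesis finC12 : finite_set (C1 `&` C2).
Hypothesis finF : finite_set F.
Hypothesis disjF : F `&` (C1 `|` C2) = set0.

Let closedF : closed F := finite_closed finF.

(** An irreducible closed set between D and the union lies in D or in the other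
    two parts; in the second case D would be finite. *)
Let component (D E : set T) : cofinite_curve D -> cofinite_curve E ->
  finite_set (D `&` E) -> irreducible_component (D `|` (E `|` F)) D.
Proof.
move=> curveD [cE _ _] finDE; have irrD := cofinite_irreducible curveD.
have [cD infD _] := curveD; split=> // W [cW _ irrW] DW.
move=> /(irrW _ _ cD (closedU cE closedF))[WD|WEF]; first exact/seteqP.
case: infD; apply: (sub_finite_set _ (_ : finite_set (D `&` E `|` F))).
  by move=> x Dx; have [Ex|Fx] := WEF _ (DW _ Dx); [left|right].
by rewrite finite_setU.
Qed.

Lemma one_dimensional_part_curves :
  one_dimensional_part (C1 `|` C2 `|` F) = C1 `|` C2.
Proof.
have [cC1 _ _] := curve1; have [cC2 _ _] := curve2.
apply/seteqP; split.
- move=> x [Z [[irrZ ZA _] dimZ] Zx]; have [cZ neZ irr] := irrZ.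
  have [|sub] := irr _ _ (closedU cC1 cC2) closedF ZA; first exact.
  by have := finite_has_dim1N (sub_finite_set sub finF) irrZ dimZ.
- move=> x [C1x|C2x].
  + exists C1 => //; split; last exact: cofinite_has_dim1.
    by rewrite -setUA; exact: component.
  + exists C2 => //; split; last exact: cofinite_has_dim1.
    rewrite -setUA setUCA; apply: component => //.
    by rewrite setIC.
Qed.

(** An open set meeting C only in x has a closed complement containing all of
    the infinite set C except x, hence containing C. *)
Let curve_isolatedN (C A : set T) x :
  cofinite_curve C -> C `<=` A -> C x -> ~ isolated A x.
Proof.
move=> curveC CA Cx [_ [V]]; rewrite nbhsE => -[U [oU Ux] UV] eV.
have [cC infC dich] := curveC.
have UC y : U y -> C y -> y = x.
  by move=> Uy Cy; have : [set x] y by rewrite -eV; split;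
    [exact: UV|exact: CA].
have [sub|fin] := dich (~` U) (open_closedC oU); first exact: (sub _ Cx).
apply: infC; apply: (sub_finite_set _ (_ : finite_set (C `&` ~` U `|` [set
  x]))).
  move=> y Cy; have [Uy|nUy] := pselect (U y); [right; exact: UC|by left].
by rewrite finite_setU; split.
Qed.

Lemma isolated_curves : isolated (C1 `|` C2 `|` F) = F.
Proof.
have [cC1 _ _] := curve1; have [cC2 _ _] := curve2.
apply/seteqP; split=> x.
- move=> iso; have := isolatedS iso; move=> [[Cx|Cx]|//].
  + by case: (curve_isolatedN curve1 _ Cx iso) => y; left; left.
  + by case: (curve_isolatedN curve2 _ Cx iso) => y; left; right.
- move=> Fx; split; first by rewrite inE; right.
  have nCx : ~ (C1 `|` C2) x by move=> Cx; have : set0 x by rewrite -disjF.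
  exists (~` (C1 `|` C2 `|` (F `\ x))).
    apply: open_nbhs_nbhs; split; last by case=> // -[_ /(_ erefl)].
    apply: closed_openC; apply: closedU; first exact: closedU.
    by apply: finite_closed; apply: finite_setD.
  apply/seteqP; split=> [y [nA [Cy|Fy]]|_ ->].
  + by case: nA; left.
  + by apply: contrapT => yx; apply: nA; right.
  + by split; [case=> // -[_ /(_ erefl)] | right].
Qed.

End TwoCurvesAndPoints.
End FiniteClosed.

(** * Functions on a biquadratic cover of the line *)

Section Biquadratic.
Variable F : numFieldType.
Implicit Types A B a b c d : {poly F}.

(** A is not a square in the field of rational functions; g is a denominator. *)
Definition nonsquare A : Prop :=
  forall f g : {poly F}, f ^+ 2 = g ^+ 2 * A -> g = 0.

(** The multiplicity of r is even in f^2 and odd in g^2 A. *)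
Lemma simple_root_nonsquare A r : root A r -> A^`().[r] != 0 -> nonsquare A.
Proof.
move=> /factor_theorem[C ->]; rewrite derivM derivXsubC mulr1 hornerD hornerM.
rewrite hornerXsubC subrr mulr0 add0r => Cr f g e.
have C0 : C != 0 by apply: contraNneq Cr => ->; rewrite horner0.
apply/eqP; apply: contraT => g0.
have X0 : 'X - r%:P != 0 :> {poly F} by rewrite polyXsubC_eq0.
have f0 : f != 0.
  have : f ^+ 2 != 0 by rewrite e !mulf_neq0 // expf_neq0.
  by rewrite expf_eq0.
have := congr1 (mup r) e; rewrite !expr2 !mupM ?mulf_neq0 //.
rewrite (mupNroot (q := C)) // (mup_XsubCX 1 r r) eqxx add0n !addnn => odd_eq.
by have := congr1 odd odd_eq; rewrite addn1 /= !odd_double.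
Qed.

(** The difference of the two sides of the hypothesis is the norm to F(s) of
    a + b sqrt A + (c + d sqrt A) sqrt B.  As A, B and AB are not squares, the
    two square roots generate a field of degree 4, where only 0 has norm 0. *)
Lemma biquadratic_norm_eq0 A B a b c d :
  nonsquare A -> nonsquare B -> nonsquare (A * B) ->
  (a ^+ 2 + b ^+ 2 * A - (c ^+ 2 + d ^+ 2 * A) * B) ^+ 2 =
    (2 * (a * b - c * d * B)) ^+ 2 * A ->
  [/\ a = 0, b = 0, c = 0 & d = 0].
Proof.
move=> nA nB nAB e.
have sq0 (f : {poly F}) : f ^+ 2 = 0 -> f = 0 by move/eqP;
  rewrite expf_eq0 => /eqP.
have V0 := nA _ _ e.
have U0 := e; rewrite V0 expr0n mul0r in U0; have {}U0 := sq0 _ U0.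
have {}V0 : a * b - c * d * B = 0.
  have two0 : (2 : {poly F}) != 0 by rewrite -polyC_natr polyC_eq0 pnatr_eq0.
  by move/eqP: V0; rewrite mulf_eq0 (negbTE two0) => /eqP.
(* a is eliminated from a^2 + b^2 A = (c^2 + d^2 A) B, multiplied by b^2, with
   the help of a b = c d B; the result factors. *)
have : (c ^+ 2 * B - b ^+ 2 * A) * (d ^+ 2 * B - b ^+ 2) = 0.
  transitivity ((a ^+ 2 + b ^+ 2 * A - (c ^+ 2 + d ^+ 2 * A) * B) * b ^+ 2
                - (a * b - c * d * B) * (a * b + c * d * B)); first by ring.
  by rewrite U0 V0; ring.
move/eqP; rewrite mulf_eq0 => /orP[]/eqP/subr0_eq E.
- have b0 : b = 0.
    apply: (nAB (c * B)); transitivity (c ^+ 2 * B * B); first by ring.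
    by rewrite E; ring.
  have c0 : c = 0 by apply: (nB 0); rewrite E b0; ring.
  have a2 : a ^+ 2 = d ^+ 2 * (A * B).
    by apply: subr0_eq; rewrite -[RHS]U0 b0 c0; ring.
  have d0 : d = 0 := nAB _ _ a2.
  by split=> //; apply: sq0; rewrite a2 d0; ring.
- have d0 : d = 0 by apply: (nB b).
  have b0 : b = 0 by apply: sq0; rewrite -E d0; ring.
  have a2 : a ^+ 2 = c ^+ 2 * B.
    by apply: subr0_eq; rewrite -[RHS]U0 b0 d0; ring.
  have c0 : c = 0 := nB _ _ a2.
  by split=> //; apply: sq0; rewrite a2 c0; ring.
Qed.

Variables A B : {poly F}.

Definition on_cover (s P M : F) : Prop := P ^+ 2 = A.[s] /\ M ^+ 2 = B.[s].

(** Regular functions on the cover, expanded in the basis 1, P, M, PM over F[s].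
    They are given by their values, which avoids a quotient ring. *)
Definition biquadratic (g : F -> F -> F -> F) : Prop :=
  exists a b c d : {poly F}, forall s P M, on_cover s P M ->
    g s P M = a.[s] + b.[s] * P + (c.[s] + d.[s] * P) * M.

Lemma biquadratic_poly a : biquadratic (fun s _ _ => a.[s]).
Proof.
by exists a, 0, 0, 0 => s P M _; rewrite !horner0 !mul0r !addr0 mul0r addr0.
Qed.

Lemma biquadraticD (g h : F -> F -> F -> F) : biquadratic g -> biquadratic h ->
  biquadratic (fun s P M => g s P M + h s P M).
Proof.
move=> [a [b [c [d e]]]] [a' [b' [c' [d' e']]]].
exists (a + a'), (b + b'), (c + c'), (d + d') => s P M on.
by rewrite e // e' // !hornerD; ring.
Qed.

Lemma biquadraticM (g h : F -> F -> F -> F) : biquadratic g -> biquadratic h ->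
  biquadratic (fun s P M => g s P M * h s P M).
Proof.
move=> [a [b [c [d e]]]] [a' [b' [c' [d' e']]]].
exists (a * a' + b * b' * A + c * c' * B + d * d' * A * B),
  (a * b' + b * a' + (c * d' + d * c') * B),
  (a * c' + c * a' + (b * d' + d * b') * A),
  (a * d' + d * a' + b * c' + c * b') => s P M on.
rewrite e // e' //; have [PA MB] := on.
by rewrite !(hornerD, hornerM) -PA -MB; ring.
Qed.

Lemma biquadraticX g n :
  biquadratic g -> biquadratic (fun s P M => g s P M ^+ n).
Proof.
move=> bg; elim: n => [|n IH].
  have [a [b [c [d e]]]] := biquadratic_poly 1; exists a, b, c, d => s P M on.
  by rewrite expr0 -e // hornerC.
have [a [b [c [d e]]]] := biquadraticM bg IH; exists a, b, c, d => s P M on.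
by rewrite exprS -e.
Qed.

Lemma biquadratic_eq g h :
  biquadratic g -> (forall s P M, h s P M = g s P M) -> biquadratic h.
Proof.
move=> [a [b [c [d e]]]] hg; exists a, b, c, d => s P M on.
by rewrite hg e.
Qed.

Lemma biquadratic_meval n (f : {mpoly F[n]}) (w : 'I_n -> F -> F -> F -> F) :
  (forall j, biquadratic (w j)) ->
  biquadratic (fun s P M => f.@[fun j => w j s P M]).
Proof.
move=> bw; pose term m s P M := f@_m * \prod_i w i s P M ^+ m i.
have bterm m : biquadratic (term m).
  have [] : biquadratic (fun s P M => \prod_i w i s P M ^+ m i).
    elim: (index_enum _) => [|j r IH].
      apply: (biquadratic_eq (biquadratic_poly 1)) => s P M.
      by rewrite big_nil hornerC.
    apply: (biquadratic_eq (biquadraticM (biquadraticX (m j) (bw j)) IH)).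
    by move=> s P M; rewrite big_cons.
  move=> a aP; apply: (biquadratic_eq (biquadraticM
    (biquadratic_poly (f@_m)%:P) (ex_intro _ a aP))) => s P M.
  by rewrite hornerC.
apply: (@biquadratic_eq (fun s P M => \sum_(m <- msupp f) term m s P M)).
  elim: (msupp f) => [|m r IH].
    apply: (biquadratic_eq (biquadratic_poly 0)) => s P M.
    by rewrite big_nil horner0.
  apply: (biquadratic_eq (biquadraticD (bterm m) IH)) => s P M.
  by rewrite big_cons.
by move=> s P M; rewrite mevalE.
Qed.

Hypotheses (nA : nonsquare A) (nB : nonsquare B) (nAB : nonsquare (A * B)).

(** N is the norm of g.  If it vanishes, all four coefficients of g do;
    otherwise the zeros of g lie over its finitely many roots. *)
Lemma biquadratic_zeros g : biquadratic g ->
  (forall s P M, on_cover s P M -> g s P M = 0) \/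
  (exists2 N : {poly F}, N != 0 &
    forall s P M, on_cover s P M -> g s P M = 0 -> root N s).
Proof.
move=> [a [b [c [d e]]]].
pose U := a ^+ 2 + b ^+ 2 * A - (c ^+ 2 + d ^+ 2 * A) * B.
pose V := 2 * (a * b - c * d * B).
have [NUV|NUV] := eqVneq (U ^+ 2 - V ^+ 2 * A) 0.
  left=> s P M on; rewrite e //.
  have [|-> -> -> ->] := biquadratic_norm_eq0 (a := a) (b := b) (c := c) (d :=
    d) nA nB nAB.
    exact: subr0_eq NUV.
  by rewrite !horner0; ring.
right; exists (U ^+ 2 - V ^+ 2 * A) => // s P M on.
rewrite e // => zero; have [PA MB] := on.
(* This is (a + b P)^2 = (c + d P)^2 B, rewritten as U + V P = 0. *)
have UV : U.[s] = - V.[s] * P.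
  have sq : (a.[s] + b.[s] * P) ^+ 2 = ((c.[s] + d.[s] * P) * M) ^+ 2.
    by rewrite -(addr0_eq zero) sqrrN.
  apply/eqP; rewrite -subr_eq0 mulNr opprK; apply/eqP.
  rewrite -(subrr (((c.[s] + d.[s] * P) * M) ^+ 2)) -{1}sq.
  rewrite /U /V !(hornerD, hornerM, hornerN, horner_exp) -PA -MB.
  by rewrite hornerC; ring.
rewrite rootE hornerD hornerN (hornerM (V ^+ 2)) !horner_exp UV -PA.
by apply/eqP; ring.
Qed.

End Biquadratic.

(** * Points in coordinates, and the topology *)

Section Coordinates.
Variable R : realType.
Local Notation C := R[i].

Definition vec5 (x0 x1 x2 x3 x4 : C) : 'rV[C]_5 :=
  \row_j [:: x0; x1; x2; x3; x4]`_j.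

Lemma vec5P (v : 'rV[C]_5) : v = vec5 (v 0 0) (v 0 1) (v 0 2) (v 0 3) (v 0 4).
Proof.
apply/rowP; case=> [[|[|[|[|[|j]]]]] jlt] //; rewrite !mxE /=;
  by congr (v _ _); apply: val_inj.
Qed.

Lemma vec5_eq (x0 x1 x2 x3 x4 y0 y1 y2 y3 y4 : C) :
  vec5 x0 x1 x2 x3 x4 = vec5 y0 y1 y2 y3 y4 <->
  [/\ x0 = y0, x1 = y1, x2 = y2, x3 = y3 & x4 = y4].
Proof.
split=> [/rowP e|[-> -> -> -> ->] //].
by have := (e 0, e 1, e 2, e 3, e 4); rewrite !mxE /= => -[[[[]]]].
Qed.

Lemma vec5_diag (x0 x1 x2 x3 x4 d0 d1 d2 d3 d4 : C) :
  vec5 x0 x1 x2 x3 x4 *m diag_mx (vec5 d0 d1 d2 d3 d4) =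
  vec5 (x0 * d0) (x1 * d1) (x2 * d2) (x3 * d3) (x4 * d4).
Proof.
apply/rowP; case=> [[|[|[|[|[|j]]]]] jlt] //;
  by rewrite mulmx_diagE !mxE.
Qed.

Lemma vec5_neq0 (x0 x1 x2 x3 x4 : C) :
  (vec5 x0 x1 x2 x3 x4 != 0) =
  [|| x0 != 0, x1 != 0, x2 != 0, x3 != 0 | x4 != 0].
Proof.
apply/idP/idP; last first.
  apply: contraTneq => e0; have e j : (vec5 x0 x1 x2 x3 x4) 0 j = 0.
    by rewrite e0 mxE.
  by have := (e 0, e 1, e 2, e 3, e 4); rewrite !mxE /= => -[[[[->
    ->] ->] ->] ->];
    rewrite eqxx.
apply: contraNT; rewrite !negb_or !negbK.
move=> /and5P[/eqP-> /eqP-> /eqP-> /eqP-> /eqP->]; apply/eqP/rowP.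
by case=> [[|[|[|[|[|j]]]]] jlt] //; rewrite !mxE.
Qed.

Lemma torusE (l : C) : torus l = diag_mx (vec5 l l (l ^+ 4) (l ^+ 4) (l ^+ 4)).
Proof.
congr diag_mx; apply/rowP; case=> [[|[|[|[|[|j]]]]] jlt] //;
  by rewrite !mxE /weight /= ?expr1.
Qed.

Let one_neq0 : const_mx 1 != 0 :> 'rV[C]_5.
Proof.
by apply/eqP => /rowP/(_ 0)/eqP; rewrite !mxE oner_eq0.
Qed.

(** Off the punctured cone the value is irrelevant; it is set to the class of a
    fixed vector so that points can be written without carrying proofs. *)
Definition pt (v : 'rV[C]_5) : wproj R :=
  \pi_(wproj R) (insubd (exist _ (const_mx 1) one_neq0 : punctured R) v).

Lemma pt_pi (v : punctured R) : pt (val v) = \pi_(wproj R) v.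
Proof. by rewrite /pt valKd. Qed.

Lemma pt_coords (p : wproj R) : pt (\row_j coords p j) = p.
Proof.
rewrite (_ : \row_j _ = val (repr p)) ?pt_pi ?reprK //.
by apply/rowP => j; rewrite mxE.
Qed.

Lemma coords_neq0 (p : wproj R) : \row_j coords p j != 0.
Proof.
rewrite (_ : \row_j _ = val (repr p)) ?(valP (repr p)) //.
by apply/rowP => j; rewrite mxE.
Qed.

Lemma pt_eq (v w : 'rV[C]_5) : v != 0 -> w != 0 ->
  pt v = pt w <-> exists2 l : C, l != 0 & w = v *m torus l.
Proof.
by move=> v0 w0; rewrite /pt -wproj_eqP !val_insubd v0 w0.
Qed.

Lemma mulmx_unit_neq0 (v : 'rV[C]_5) (M : 'M[C]_5) :
  v != 0 -> M \in unitmx -> v *m M != 0.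
Proof.
by move=> v0 MU; apply: contraNneq v0 => e; rewrite -(mulmxK MU v) e mul0mx.
Qed.

Lemma sigma_pt (v : 'rV[C]_5) : v != 0 -> sigma (pt v) = pt (v *m sigma_mx R).
Proof.
move=> v0; rewrite /sigma /pt act_pi ?sigma_mx_unit //; congr (\pi _).
apply: val_inj; rewrite val_act_vec ?sigma_mx_unit // !val_insubd v0.
by rewrite mulmx_unit_neq0 ?sigma_mx_unit.
Qed.

Lemma tau_pt (v : 'rV[C]_5) : v != 0 -> tau (pt v) = pt (v *m tau_mx R).
Proof.
move=> v0; rewrite /tau /pt act_pi ?tau_mx_unit //; congr (\pi _).
apply: val_inj; rewrite val_act_vec ?tau_mx_unit // !val_insubd v0.
by rewrite mulmx_unit_neq0 ?tau_mx_unit.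
Qed.

Lemma surfY_pt (a b : 'rV[C]_6) (v : 'rV[C]_5) : v != 0 ->
  surfY a b (pt v) <-> (q0 a).@[v 0] = 0 /\ (q2 b).@[v 0] = 0.
Proof.
by move=> v0; rewrite /pt; apply: (iff_trans (surfY_pi a b _));
  rewrite val_insubd v0.
Qed.

Lemma whomog_scale (f : {mpoly C[5]}) d (v : 'rV[C]_5) (l : C) : whomog f d ->
  f.@[(v *m torus l) 0] = l ^+ d * f.@[v 0].
Proof.
move=> hf; rewrite !mevalE mulr_sumr; rewrite !big_seq; apply: eq_bigr => m.
move=> /hf <-; rewrite -prodrXr mulrCA -big_split /=; congr (_ * _).
by apply: eq_bigr => j _; rewrite mulmx_diagE mxE exprMn -exprM mulnC mulrC.
Qed.

Lemma whomog_pt (f : {mpoly C[5]}) d (v : 'rV[C]_5) : whomog f d -> v != 0 ->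
  (f.@[coords (pt v)] == 0) = (f.@[v 0] == 0).
Proof.
move=> hf v0; have [l l0 e] := (pt_eq (coords_neq0 (pt v)) v0).1 (pt_coords _).
rewrite [v in RHS]e (whomog_scale _ _ hf) mulf_eq0 expf_eq0 (negbTE l0) andbF
  /=.
by congr (_ == _); apply: meval_eq => j; rewrite mxE.
Qed.

End Coordinates.

Section Topology.
Variable R : realType.
Local Notation C := R[i].

Lemma whomogXU (j : 'I_5) : whomog ('X_j : {mpoly C[5]}) (weight j).
Proof.
move=> m; rewrite msuppX inE => /eqP->.
rewrite (bigD1 j) //= mnm1E eqxx mul1n big1 ?addn0 // => k kj.
by rewrite mnm1E eq_sym (negbTE kj).
Qed.

Lemma whomogM (f g : {mpoly C[5]}) d e :
  whomog f d -> whomog g e -> whomog (f * g) (d + e)%N.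
Proof.
move=> hf hg m /msuppM_le /allpairsP [[m1 m2] /= [i1 i2 ->]].
rewrite -(hf _ i1) -(hg _ i2) -big_split /=.
by apply: eq_bigr => j _; rewrite mnmDE mulnDl.
Qed.

Lemma whomogX (f : {mpoly C[5]}) d n :
  whomog f d -> whomog (f ^+ n) (n * d)%N.
Proof.
move=> hf; elim: n => [|n IH]; last by rewrite exprS mulSn; exact: whomogM.
move=> m; rewrite expr0 msupp1 inE => /eqP->.
by rewrite big1 // => j _; rewrite mnm0E.
Qed.

Lemma whomogD (f g : {mpoly C[5]}) d :
  whomog f d -> whomog g d -> whomog (f + g) d.
Proof. by move=> hf hg m /msuppD_le; rewrite mem_cat => /orP[/hf|/hg]. Qed.

Lemma whomogZ (c : C) (f : {mpoly C[5]}) d : whomog f d -> whomog (c *: f) d.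
Proof. by move=> hf m /msuppZ_le /hf. Qed.

Lemma wproj_openE (U : set (wproj R)) : open U = zariski_open U.
Proof. by []. Qed.

Lemma closed_zeros (f : {mpoly C[5]}) d :
  whomog f d -> closed [set p : wproj R | f.@[coords p] = 0].
Proof.
move=> hf; rewrite -openC wproj_openE => p /= /eqP fp.
by exists f, d; split=> // r fr; exact/eqP.
Qed.

(** Closed sets are cut out by weighted homogeneous polynomials, one point
    outside at a time. *)
Lemma closed_separate (K : set (wproj R)) p : closed K -> ~ K p ->
  exists f d, [/\ whomog f d, f.@[coords p] != 0 &
                  forall r, K r -> f.@[coords r] = 0].
Proof.
rewrite -openC wproj_openE => /(_ p) sep /sep[f [d [hf fp fK]]]; exists f, d;
  split=> // r Kr.
by apply/eqP; apply: contraT => /fK; exact.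
Qed.

(** Degree 4 forms separate points: they determine the ratio of the weight 4
    coordinates and, through u1^4 and u1^3 u3, the point (u1 : u3). *)
Lemma forms4_separate (v w : 'rV[C]_5) : v != 0 -> w != 0 ->
  (forall f g : {mpoly C[5]}, whomog f 4 -> whomog g 4 ->
    f.@[v 0] * g.@[w 0] = g.@[v 0] * f.@[w 0]) -> pt v = pt w.
Proof.
move=> v0 w0 prop; apply/(pt_eq v0 w0).
have hy (j : 'I_5) : (1 < j)%N -> whomog ('X_j : {mpoly C[5]}) 4.
  by have := @whomogXU j; case: j => [[|[|[|[|[|]]]]]].
have hu (j : 'I_5) : (j < 2)%N -> whomog ('X_j ^+ 4 : {mpoly C[5]}) 4.
  by have := whomogX (n:=4) (@whomogXU j); case: j => [[|[|[|[|[|]]]]]].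
have huu : whomog ('X_0 ^+ 3 * 'X_1 : {mpoly C[5]}) 4.
  exact: (whomogM (whomogX (n:=3) (@whomogXU 0)) (@whomogXU 1)).
have [c c0 pc] : exists2 c : C, c != 0 &
    forall f : {mpoly C[5]}, whomog f 4 -> f.@[w 0] = c * f.@[v 0].
  have [g hg gv] : exists2 g : {mpoly C[5]}, whomog g 4 & g.@[v 0] != 0.
    have /existsP[j vj] : [exists j, v 0 j != 0].
      apply: contra_neqT v0; rewrite negb_exists => /forallP vj.
      by apply/rowP => j; rewrite mxE; apply/eqP; have := vj j; rewrite negbK.
    case: (ltnP j 2) => j2; [exists ('X_j ^+ 4) | exists 'X_j]; auto.
      by rewrite meval_exp mevalXU expf_neq0.
    by rewrite mevalXU.
  have pc f : whomog f 4 -> f.@[w 0] = g.@[w 0] / g.@[v 0] * f.@[v 0].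
    by move=> hf; apply: (mulfI gv); rewrite -(prop f g hf hg); field.
  exists (g.@[w 0] / g.@[v 0]) => //; apply: contra_neq w0 => c0.
  apply/rowP => j; rewrite mxE.
  case: (ltnP j 2) => j2; last first.
    by have := pc _ (hy j j2); rewrite c0 mul0r mevalXU.
  have := pc _ (hu j j2); rewrite c0 mul0r meval_exp mevalXU => /eqP.
  by rewrite expf_eq0 => /eqP.
have wy (j : 'I_5) : (1 < j)%N -> w 0 j = c * v 0 j.
  by move=> j1; have := pc _ (hy j j1); rewrite !mevalXU.
have wu (j : 'I_5) : (j < 2)%N -> w 0 j ^+ 4 = c * v 0 j ^+ 4.
  by move=> j1; have := pc _ (hu j j1); rewrite !meval_exp !mevalXU.
suff [l lc [w0E w1E]] : exists2 l : C, l ^+ 4 = c &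
    w 0 0 = l * v 0 0 /\ w 0 1 = l * v 0 1.
  exists l; first by apply: contra_neq c0 => l0; rewrite -lc l0 expr0n.
  apply/rowP => j; rewrite mulmx_diagE mxE mulrC.
  case: j => [[|[|[|[|[|j]]]]] jlt] //.
  - by rewrite expr1 (_ : Ordinal jlt = 0) //; exact: val_inj.
  - by rewrite expr1 (_ : Ordinal jlt = 1) //; exact: val_inj.
  - by rewrite wy // lc.
  - by rewrite wy // lc.
  - by rewrite wy // lc.
have root4 (x y : C) : y != 0 -> x ^+ 4 = c * y ^+ 4 ->
    (x / y) ^+ 4 = c /\ x = x / y * y.
  by move=> y0 e; rewrite divfK // expr_div_n e mulfK ?expf_neq0.
have zero4 (x y : C) : y = 0 -> x ^+ 4 = c * y ^+ 4 -> x = 0.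
  by move=> -> /eqP; rewrite expr0n mulr0 expf_eq0 => /eqP.
have [v00|v00] := eqVneq (v 0 0) 0.
  have w00 := zero4 _ _ v00 (wu 0 isT).
  have [v01|v01] := eqVneq (v 0 1) 0.
    exists (4.-root c); first exact: rootCK.
    by rewrite v00 v01 w00 (zero4 _ _ v01 (wu 1 isT)) mulr0.
  have [lc e] := root4 _ _ v01 (wu 1 isT).
  by exists (w 0 1 / v 0 1) => //; rewrite -e v00 w00 mulr0.
have [lc e] := root4 _ _ v00 (wu 0 isT).
exists (w 0 0 / v 0 0) => //; split=> //.
have ev u : ('X_0 ^+ 3 * 'X_1 : {mpoly C[5]}).@[u] = u 0 ^+ 3 * u 1.
  by have := meval_mon2 u 1 0 1 3; rewrite scale1r mul1r.
have := pc _ huu; rewrite !ev -lc.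
set l := w 0 0 / v 0 0 in e *; rewrite e => E.
have lv : (l * v 0 0) ^+ 3 != 0.
  rewrite expf_neq0 // mulf_neq0 //; apply: contra_neq c0.
  by rewrite -lc -/l => ->; rewrite expr0n.
by apply: (mulfI lv); rewrite E; ring.
Qed.

Lemma wproj_accessible : accessible_space (wproj R).
Proof.
move=> p r pr.
have [f [g [hf hg fg]]] : exists f g : {mpoly C[5]},
    [/\ whomog f 4, whomog g 4 &
        f.@[coords r] * g.@[coords p] != g.@[coords r] * f.@[coords p]].
  apply: contrapT => nsep; move/eqP: pr; apply.
  rewrite -(pt_coords p) -(pt_coords r); apply/esym.
  apply: forms4_separate; try exact: coords_neq0.
  move=> f g hf hg; apply: contrapT => fg; apply: nsep.
  have ev h q : h.@[(\row_j coords q j) 0] = h.@[coords q] :> C.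
    by apply: meval_eq => j; rewrite mxE.
  by exists f, g; split=> //; apply/eqP; rewrite -!ev.
pose h := f.@[coords r] *: g - g.@[coords r] *: f.
exists [set q | h.@[coords q] != 0]; split.
- rewrite wproj_openE => q /= hq; exists h, 4%N; split=> //.
  by rewrite /h -scaleNr; apply: whomogD; apply: whomogZ.
- by rewrite inE /= /h mevalB !mevalZ subr_eq0.
- by rewrite inE /= /h mevalB !mevalZ => /eqP; apply;
  rewrite [X in X - _]mulrC subrr.
Qed.

(** Fibres of the quotient map are sigma-orbits, hence finite. *)
Lemma wprojS_accessible : accessible_space (wprojS R).
Proof.
apply/accessible_finite_set_closed => A finA.
rewrite -openC wprojS_openE -wproj_openE preimage_setC openC.
apply: (accessible_finite_set_closed.1 wproj_accessible).
apply: (sub_finite_set _ (_ : finite_set (\bigcup_(x in A)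
  [set iter (k : 'I_4) (@sigma R) (repr x) | k in [set: 'I_4]]))).
  move=> p Ap; exists (\pi_(wprojS R) p) => //=.
  have /wprojS_eqP [k e] := reprK (\pi_(wprojS R) p).
  exists (inord (k %% 4)) => //; rewrite inordK ?ltn_pmod //.
  move: (repr _) e => q ->.
  by rewrite {2}(divn_eq k 4) addnC iterD mulnC iter_sigma4.
by apply: bigcup_finite => // x _; exact/finite_image/finite_finset.
Qed.

End Topology.

Section Points.
Variable R : realType.
Local Notation C := R[i].

Definition pt5 (x0 x1 x2 x3 x4 : C) : wproj R := pt (vec5 x0 x1 x2 x3 x4).
Definition q5 (x0 x1 x2 x3 x4 : C) : wprojS R :=
  \pi_(wprojS R) (pt5 x0 x1 x2 x3 x4).

Lemma pt5P (p : wproj R) : exists x0 x1 x2 x3 x4 : C,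
  vec5 x0 x1 x2 x3 x4 != 0 /\ p = pt5 x0 x1 x2 x3 x4.
Proof.
have := coords_neq0 p; rewrite [X in X != 0]vec5P => v0.
by do 5!eexists; split; first exact: v0; rewrite /pt5 -vec5P pt_coords.
Qed.

Lemma pt5_eq (x0 x1 x2 x3 x4 y0 y1 y2 y3 y4 : C) :
  vec5 x0 x1 x2 x3 x4 != 0 -> vec5 y0 y1 y2 y3 y4 != 0 ->
  pt5 x0 x1 x2 x3 x4 = pt5 y0 y1 y2 y3 y4 <->
  exists2 l : C, l != 0 & [/\ y0 = l * x0, y1 = l * x1, y2 = l ^+ 4 * x2,
    y3 = l ^+ 4 * x3 & y4 = l ^+ 4 * x4].
Proof.
move=> x0N y0N; rewrite /pt5 pt_eq //.
split=> -[l l0 e]; exists l => //.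
  by move: e; rewrite torusE vec5_diag => /vec5_eq; rewrite ![_ * x0]mulrC
    ![_ * x1]mulrC ![_ * x2]mulrC ![_ * x3]mulrC ![_ * x4]mulrC.
rewrite torusE vec5_diag; apply/vec5_eq.
by rewrite [x0 * _]mulrC [x1 * _]mulrC [x2 * _]mulrC [x3 * _]mulrC [x4 *
  _]mulrC.
Qed.

Lemma eps8 : eps R ^+ 8 = 1.
Proof. by rewrite (exprM _ 4 2) eps4 sqrrN expr1n. Qed.

Lemma eps_neq0 : eps R != 0.
Proof.
by apply/eqP => e0; have := eps8; rewrite e0 expr0n /= => /esym/eqP;
  rewrite oner_eq0.
Qed.

Lemma sigma_pt5 (x0 x1 x2 x3 x4 : C) : vec5 x0 x1 x2 x3 x4 != 0 ->
  sigma (pt5 x0 x1 x2 x3 x4) =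
  pt5 (eps R * x0) (eps R ^+ 3 * x1) (eps R ^+ 2 * x2) x3 (eps R ^+ 6 * x4).
Proof.
move=> x0N; rewrite /pt5 sigma_pt //; congr pt.
rewrite (_ : sigma_mx R = diag_mx (vec5 (eps R) (eps R ^+ 3) (eps R ^+ 2) 1
  (eps R ^+ 6))).
  by rewrite vec5_diag; apply/vec5_eq; split; rewrite ?mulr1 // mulrC.
have e6 : eps R ^+ 6 = - 'i%C by rewrite (exprD _ 4 2) eps4 eps2 mulN1r.
by rewrite e6 eps2.
Qed.

Lemma tau_pt5 (x0 x1 x2 x3 x4 : C) : vec5 x0 x1 x2 x3 x4 != 0 ->
  tau (pt5 x0 x1 x2 x3 x4) = pt5 ('i%C * x0) (- 'i%C * x1) x2 x3 x4.
Proof.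
move=> x0N; rewrite /pt5 tau_pt //; congr pt.
rewrite (_ : tau_mx R = diag_mx (vec5 'i%C (- 'i%C) 1 1 1)) //.
by rewrite vec5_diag; apply/vec5_eq; split; rewrite ?mulr1 // mulrC.
Qed.

Lemma vec5_scale_neq0 (x0 x1 x2 x3 x4 d0 d1 d2 d3 d4 : C) :
  [&& d0 != 0, d1 != 0, d2 != 0, d3 != 0 & d4 != 0] ->
  vec5 x0 x1 x2 x3 x4 != 0 ->
  vec5 (d0 * x0) (d1 * x1) (d2 * x2) (d3 * x3) (d4 * x4) != 0.
Proof.
move=> /and5P[h0 h1 h2 h3 h4]; rewrite !vec5_neq0 !mulf_eq0.
by rewrite (negbTE h0) (negbTE h1) (negbTE h2) (negbTE h3) (negbTE h4).
Qed.

Lemma sigma_vec5_neq0 (e x0 x1 x2 x3 x4 : C) : e != 0 ->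
  vec5 x0 x1 x2 x3 x4 != 0 ->
  vec5 (e * x0) (e ^+ 3 * x1) (e ^+ 2 * x2) x3 (e ^+ 6 * x4) != 0.
Proof.
move=> e0 v0; have := @vec5_scale_neq0 _ _ _ _ _ e (e ^+ 3) (e ^+ 2) 1 (e ^+ 6)
  _ v0.
by rewrite mul1r oner_eq0 !expf_eq0 /= !e0; exact.
Qed.

Lemma tau_vec5_neq0 (x0 x1 x2 x3 x4 : C) : vec5 x0 x1 x2 x3 x4 != 0 ->
  vec5 ('i%C * x0) (- 'i%C * x1) x2 x3 x4 != 0.
Proof.
have i0 : 'i%C != 0 :> C by rewrite eq_complex /= oner_eq0 andbF.
move=> v0; have := @vec5_scale_neq0 _ _ _ _ _ 'i%C (- 'i%C) 1 1 1 _ v0.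
by rewrite !mul1r oppr_eq0 i0 oner_eq0; exact.
Qed.

Lemma iter_sigma_pt5 k (x0 x1 x2 x3 x4 : C) : vec5 x0 x1 x2 x3 x4 != 0 ->
  let e := eps R ^+ k in
  iter k (@sigma R) (pt5 x0 x1 x2 x3 x4) =
  pt5 (e * x0) (e ^+ 3 * x1) (e ^+ 2 * x2) x3 (e ^+ 6 * x4).
Proof.
move=> v0 /=; elim: k => [|k /= ->]; first by rewrite expr0 !expr1n !mul1r.
rewrite sigma_pt5; last by rewrite sigma_vec5_neq0 ?expf_neq0 ?eps_neq0.
by congr pt5; rewrite mulrA ?exprS //; ring.
Qed.

Lemma q5_eq (x0 x1 x2 x3 x4 y0 y1 y2 y3 y4 : C) :
  vec5 x0 x1 x2 x3 x4 != 0 -> vec5 y0 y1 y2 y3 y4 != 0 ->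
  q5 x0 x1 x2 x3 x4 = q5 y0 y1 y2 y3 y4 <->
  exists k (l : C), let e := eps R ^+ k in l != 0 /\
    [/\ y0 = l * (e * x0), y1 = l * (e ^+ 3 * x1),
        y2 = l ^+ 4 * (e ^+ 2 * x2), y3 = l ^+ 4 * x3 &
        y4 = l ^+ 4 * (e ^+ 6 * x4)].
Proof.
move=> x0N y0N; rewrite /q5 -wprojS_eqP.
have eN k := @sigma_vec5_neq0 (eps R ^+ k) _ _ _ _ _ (expf_neq0 k eps_neq0) x0N.
split=> [[k]|[k [l [l0 e]]]].
  move/esym; rewrite iter_sigma_pt5 // => /pt5_eq[//|//|l l0 e].
  by exists k, l.
exists k; rewrite iter_sigma_pt5 //; apply/esym/pt5_eq => //.
by exists l.
Qed.

Lemma surfY_pt5 (a b : 'rV[C]_6) (x0 x1 x2 x3 x4 : C) :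
  vec5 x0 x1 x2 x3 x4 != 0 ->
  surfY a b (pt5 x0 x1 x2 x3 x4) <->
  a 0 0 * x0 ^+ 8 + a 0 1 * (x0 ^+ 4 * x1 ^+ 4) + a 0 2 * x1 ^+ 8
    + a 0 3 * (x0 ^+ 2 * x1 ^+ 2 * x3) + a 0 4 * x3 ^+ 2 + a 0 5 * (x2 * x4) = 0
  /\
  b 0 0 * (x0 ^+ 6 * x1 ^+ 2) + b 0 1 * (x0 ^+ 2 * x1 ^+ 6)
    + b 0 2 * (x0 ^+ 4 * x3) + b 0 3 * (x1 ^+ 4 * x3)
    + b 0 4 * x2 ^+ 2 + b 0 5 * x4 ^+ 2 = 0.
Proof. by move=> v0; rewrite /pt5 surfY_pt // q0E q2E !mxE /=. Qed.

End Points.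

(** * The fixed curves as biquadratic covers *)

Section CurveForm.
Variable F : numClosedFieldType.

(** The chart [i = false] is u = 1, y2 = s and the chart [i = true] is
    u = s, y2 = 1. *)
Definition chartU (i : bool) : {poly F} := if i then 'X else 1.
Definition chartY (i : bool) : {poly F} := if i then 1 else 'X.

(** The right-hand sides A and B of the equations P^2 = A, M^2 = B of a fixed
    curve are, up to the choice of chart, of the shape
    - (al u^8 + be u^4 y2 + ga y2^2). *)
Definition form (i : bool) (al be ga : F) : {poly F} :=
  - (al *: chartU i ^+ 8 + be *: (chartU i ^+ 4 * chartY i)
     + ga *: chartY i ^+ 2).

Lemma formE i al be ga s : (form i al be ga).[s] =
  - (al * (chartU i).[s] ^+ 8 + be * ((chartU i).[s] ^+ 4 * (chartY i).[s])
     + ga * (chartY i).[s] ^+ 2).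
Proof. by rewrite /form hornerN !hornerD !hornerZ (hornerM (chartU i ^+ 4))
  !horner_exp. Qed.

Lemma quadratic_root (al be ga : F) : al != 0 -> be ^+ 2 - 4 * al * ga != 0 ->
  exists t : F, al * t ^+ 2 + be * t + ga = 0 /\ 2 * al * t + be != 0.
Proof.
move=> al0 disc; pose d := sqrtC (be ^+ 2 - 4 * al * ga).
have dd : d ^+ 2 = be ^+ 2 - 4 * al * ga := sqrtCK _.
exists ((d - be) / (2 * al)); split; last first.
  rewrite (_ : _ + be = d); first by rewrite sqrtC_eq0.
  by field; rewrite al0.
transitivity ((d ^+ 2 - (be ^+ 2 - 4 * al * ga)) / (4 * al)).
  by field; rewrite al0.
by rewrite dd subrr mul0r.
Qed.

(** Both charts reduce to a quadratic equation with nonzero discriminant, for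
    t = u^4 or t = y2.  The sum of the two forms is - 2 be u^4 y2, which does
    not vanish at a root of either, so they have no common root. *)
Lemma form_simple_root i (al be ga : F) :
  al != 0 -> be != 0 -> ga != 0 -> be ^+ 2 - 4 * al * ga != 0 ->
  exists r, [/\ root (form i al be ga) r, (form i al be ga)^`().[r] != 0 &
                ~~ root (form i (- al) be (- ga)) r].
Proof.
move=> al0 be0 ga0 disc; have two0 : (2 : F) != 0 by rewrite pnatr_eq0.
case: i.
- have [t [t0 dt]] := quadratic_root al0 disc.
  have tN0 : t != 0.
    by apply: contra_neq ga0 => tz; rewrite -t0 tz; ring.
  pose r := 4.-root t; have r4 : r ^+ 4 = t by exact: rootCK.
  have rN0 : r != 0 by apply: contra_neq tN0 => rz; rewrite -r4 rz expr0n.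
  exists r; split.
  + rewrite rootE formE /= hornerX hornerC; apply/eqP.
    rewrite -[RHS]oppr0 -t0; congr (- _).
    by rewrite -r4; ring.
  + rewrite /form /chartU /chartY derivN hornerN oppr_eq0.
    rewrite mulr1 expr1n !derivD !derivZ !derivXn derivC scaler0 addr0.
    rewrite hornerD !hornerZ !hornerMn !hornerXn.
    rewrite (_ : _ + _ = 4 * r ^+ 3 * (2 * al * t + be)).
      by rewrite !mulf_neq0 // ?expf_neq0 // pnatr_eq0.
    by rewrite -r4; ring.
  + rewrite rootE formE /= hornerX hornerC.
    rewrite (_ : - _ = al * t ^+ 2 + be * t + ga - 2 * (be * t)).
      by rewrite t0 sub0r oppr_eq0 !mulf_neq0.
    by rewrite -r4; ring.
- have [|t [t0 dt]] := @quadratic_root ga be al ga0.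
    by rewrite (_ : 4 * ga * al = 4 * al * ga) //; ring.
  have tN0 : t != 0.
    by apply: contra_neq al0 => tz; rewrite -t0 tz; ring.
  exists t; split.
  + rewrite rootE formE /= hornerX hornerC; apply/eqP.
    by rewrite -[RHS]oppr0 -t0; congr (- _); ring.
  + rewrite /form /chartU /chartY derivN hornerN oppr_eq0.
    rewrite !expr1n mul1r !derivD !derivZ !derivXn derivX derivC scaler0 add0r.
    rewrite hornerD !hornerZ hornerC hornerMn hornerXn.
    by rewrite (_ : _ + _ = 2 * ga * t + be) //; ring.
  + rewrite rootE formE /= hornerX hornerC.
    rewrite (_ : - _ = ga * t ^+ 2 + be * t + al - 2 * (be * t)).
      by rewrite t0 sub0r oppr_eq0 !mulf_neq0.
    by ring.
Qed.

Lemma form_nonsquare i (al be ga : F) :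
  al != 0 -> be != 0 -> ga != 0 -> be ^+ 2 - 4 * al * ga != 0 ->
  [/\ nonsquare (form i al be ga), nonsquare (form i (- al) be (- ga)) &
      nonsquare (form i al be ga * form i (- al) be (- ga))].
Proof.
move=> al0 be0 ga0 disc.
have [r [r0 dr nr]] := form_simple_root i al0 be0 ga0 disc.
have [|||r' [r'0 dr' _]] := @form_simple_root i (- al) be (- ga) _ be0.
- by rewrite oppr_eq0.
- by rewrite oppr_eq0.
- by rewrite mulrN -mulrA mulNr mulrN opprK mulrA.
split; [exact: simple_root_nonsquare r0 dr|
        exact: simple_root_nonsquare r'0 dr'|].
apply: (simple_root_nonsquare (r := r)); first by rewrite rootM r0.
by rewrite derivM hornerD !hornerM (rootP r0) mul0r addr0 mulf_neq0.
Qed.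

End CurveForm.

Section FixedCurve.
Variable R : realType.
Local Notation C := R[i].

(** Points with u3 = 0 for [j = false], with u1 = 0 for [j = true]. *)
Definition vecj (j : bool) (u x y z : C) : 'rV[C]_5 :=
  vec5 (if j then 0 else u) (if j then u else 0) x y z.
Definition ptj (j : bool) (u x y z : C) : wproj R := pt (vecj j u x y z).

Lemma vecj_neq0 j (u x y z : C) :
  (vecj j u x y z != 0) = [|| u != 0, x != 0, y != 0 | z != 0].
Proof. by case: j; rewrite /vecj vec5_neq0 ?eqxx. Qed.

Lemma ptj_scale j (u x y z l : C) : vecj j u x y z != 0 -> l != 0 ->
  ptj j u x y z = ptj j (l * u) (l ^+ 4 * x) (l ^+ 4 * y) (l ^+ 4 * z).
Proof.
move=> v0 l0; apply/pt5_eq => //; last first.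
  by exists l => //; split=> //; case: j {v0}; rewrite ?mulr0.
have nz (d t : C) : d != 0 -> (d * t != 0) = (t != 0).
  by move=> d0; rewrite mulf_eq0 (negbTE d0).
rewrite -[vec5 _ _ _ _ _]/(vecj j _ _ _ _) vecj_neq0.
by rewrite !nz ?expf_neq0 // -(vecj_neq0 j).
Qed.

(** The equations of Y restricted to a fixed curve involve only the
    coefficients named here.  The forms A and B have the same discriminant, and
    [disc] says that it is nonzero. *)
Variables (j : bool) (al be ga h b4 b5 : C).
Hypotheses (al0 : al != 0) (be0 : be != 0) (ga0 : ga != 0) (h0 : h != 0).
Hypotheses (b40 : b4 != 0) (b50 : b5 != 0).
Hypothesis disc : be ^+ 2 * h ^+ 2 - 16 * b4 * b5 * al * ga != 0.

Definition curve_eqs (u x y z : C) : Prop :=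
  al * u ^+ 8 + ga * y ^+ 2 + h * (x * z) = 0 /\
  be * (u ^+ 4 * y) + b4 * x ^+ 2 + b5 * z ^+ 2 = 0.

Definition curveY : set (wproj R) :=
  [set p | exists u x y z : C,
     [/\ vecj j u x y z != 0, curve_eqs u x y z & p = ptj j u x y z]].

Let r4 : C := sqrtC b4.
Let r5 : C := sqrtC b5.
Let c : C := 2 * r4 * r5 / h.

Let r4r4 : r4 ^+ 2 = b4. Proof. exact: sqrtCK. Qed.
Let r5r5 : r5 ^+ 2 = b5. Proof. exact: sqrtCK. Qed.
Let r40 : r4 != 0. Proof. by rewrite sqrtC_eq0. Qed.
Let r50 : r5 != 0. Proof. by rewrite sqrtC_eq0. Qed.
Let two0 : (2 : C) != 0. Proof. by rewrite pnatr_eq0. Qed.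
Let c0 : c != 0. Proof. by rewrite !mulf_neq0 ?invr_eq0. Qed.

(* P = r4 x + r5 z and M = r4 x - r5 z satisfy P^2, M^2 = b4 x^2 + b5 z^2
   +/- 2 r4 r5 x z, and both b4 x^2 + b5 z^2 and h x z are forms in (u^4, y) on
   the curve. *)
Let cA i : {poly C} := form i (c * al) be (c * ga).
Let cB i : {poly C} := form i (- (c * al)) be (- (c * ga)).

Let cover_nonsquare i :
  [/\ nonsquare (cA i), nonsquare (cB i) & nonsquare (cA i * cB i)].
Proof.
apply: form_nonsquare => //; [exact: mulf_neq0 | exact: mulf_neq0 |].
rewrite (_ : _ - _ = (be ^+ 2 * h ^+ 2 - 16 * b4 * b5 * al * ga) / h ^+ 2).
  by rewrite mulf_neq0 // invr_eq0 expf_neq0.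
by rewrite /c -r4r4 -r5r5; field.
Qed.

Let chart i (s P M : C) : 'rV[C]_5 :=
  vecj j (chartU C i).[s] ((P + M) / (2 * r4)) (chartY C i).[s]
    ((P - M) / (2 * r5)).

Let chart_neq0 i s P M : chart i s P M != 0.
Proof.
by rewrite vecj_neq0; case: i;
  rewrite /chartU /chartY /= hornerC oner_eq0 ?orbT.
Qed.

Let chart_on i s P M : on_cover (cA i) (cB i) s P M ->
  curveY (pt (chart i s P M)).
Proof.
move=> [PA MB].
exists (chartU C i).[s], ((P + M) / (2 * r4)), (chartY C i).[s],
  ((P - M) / (2 * r5)).
split; [exact: chart_neq0 | | by []].
rewrite !formE in PA MB; set U := (chartU C i).[s] in PA MB *.
set Y := (chartY C i).[s] in PA MB *; split.
- transitivity (al * U ^+ 8 + ga * Y ^+ 2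
                + h * ((P ^+ 2 - M ^+ 2) / (4 * r4 * r5))).
    by field; rewrite r40 r50.
  by rewrite PA MB /c; field; rewrite r40 r50 h0.
- transitivity (be * (U ^+ 4 * Y) + (P ^+ 2 + M ^+ 2) / 2).
    by rewrite -r4r4 -r5r5; field; rewrite r40 r50.
  by rewrite PA MB; field.
Qed.

Let chart_surj i (s x z : C) :
  curve_eqs (chartU C i).[s] x (chartY C i).[s] z ->
  exists P M, on_cover (cA i) (cB i) s P M /\
    vecj j (chartU C i).[s] x (chartY C i).[s] z = chart i s P M.
Proof.
rewrite /chart /on_cover !formE; set U := (chartU C i).[s].
set Y := (chartY C i).[s] => -[e1 e2].
exists (r4 * x + r5 * z), (r4 * x - r5 * z); split; last first.
  by congr (vecj _ _ _ _ _); field.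
have xz : x * z = - (al * U ^+ 8 + ga * Y ^+ 2) / h.
  apply: (mulfI h0); rewrite [RHS]mulrC divfK //; apply/eqP.
  by rewrite -addr_eq0 addrC e1.
have q : b4 * x ^+ 2 + b5 * z ^+ 2 = - (be * (U ^+ 4 * Y)).
  by apply/eqP; rewrite -addr_eq0 addrC addrA e2.
split.
- transitivity (b4 * x ^+ 2 + b5 * z ^+ 2 + 2 * r4 * r5 * (x * z)).
    by rewrite -r4r4 -r5r5; ring.
  by rewrite q xz /c; field.
- transitivity (b4 * x ^+ 2 + b5 * z ^+ 2 - 2 * r4 * r5 * (x * z)).
    by rewrite -r4r4 -r5r5; ring.
  by rewrite q xz /c; field.
Qed.

Let curve_scale (u x y z l : C) : curve_eqs u x y z ->
  curve_eqs (l * u) (l ^+ 4 * x) (l ^+ 4 * y) (l ^+ 4 * z).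
Proof.
move=> [e1 e2]; split.
- by rewrite -[RHS](mulr0 (l ^+ 8)) -[in RHS]e1; ring.
- by rewrite -[RHS](mulr0 (l ^+ 8)) -[in RHS]e2; ring.
Qed.

Let in_chart i (rs : C -> Prop) : set (wproj R) :=
  [set p | exists s P M, [/\ rs s, on_cover (cA i) (cB i) s P M &
                             p = pt (chart i s P M)]].

(** A point outside one chart has s = 0 in the other: the coordinates u and y2
    do not vanish simultaneously on the curve. *)
Let curve_charts p i : curveY p ->
  in_chart i (fun=> True) p \/ in_chart (~~ i) (fun s => s = 0) p.
Proof.
move=> [u [x [y [z [v0 eqs ->]]]]]; rewrite /in_chart /=.
have chartF : u != 0 -> exists s P M, [/\ s = u^-1 ^+ 4 * y,
    on_cover (cA false) (cB false) s P M & ptj j u x y z = pt (chart false s P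
      M)].
  move=> u0; have l0 : u^-1 != 0 by rewrite invr_eq0.
  have := curve_scale u^-1 eqs; rewrite mulVf // => eqs'.
  have [|P [M [on e]]] := @chart_surj false (u^-1 ^+ 4 * y) (u^-1 ^+ 4 * x)
    (u^-1 ^+ 4 * z).
    by rewrite /= hornerX hornerC.
  exists (u^-1 ^+ 4 * y), P, M; split=> //.
  by rewrite (ptj_scale v0 l0) /ptj mulVf // -e /= hornerX hornerC.
have chartT : y != 0 -> exists s P M, [/\ (u = 0 -> s = 0),
    on_cover (cA true) (cB true) s P M & ptj j u x y z = pt (chart true s P M)].
  move=> y0; pose l := 4.-root y^-1; have l4 : l ^+ 4 = y^-1 by exact: rootCK.
  have l0 : l != 0 by have := expf_eq0 l 4;
    rewrite l4 invr_eq0 (negbTE y0) /= => <-.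
  have := curve_scale l eqs; rewrite [in l ^+ 4 * y]l4 mulVf // => eqs'.
  have [|P [M [on e]]] := @chart_surj true (l * u) (l ^+ 4 * x) (l ^+ 4 * z).
    by rewrite /= hornerX hornerC.
  exists (l * u), P, M; split=> //; first by move=> ->; rewrite mulr0.
  rewrite (ptj_scale v0 l0) /ptj -e /= hornerX hornerC.
  by rewrite [in l ^+ 4 * y]l4 mulVf.
have uy0 : u = 0 -> y != 0.
  move=> u0; apply: contraNneq v0 => y0; case: eqs;
    rewrite u0 y0 -[vecj _ _ _ _ _ == 0]negbK vecj_neq0.
  rewrite !expr0n /= !mulr0 !add0r => /eqP.
  rewrite mulf_eq0 (negbTE h0) mulf_eq0 /= => /orP[]/eqP-> /eqP.
    by rewrite expr0n /= mulr0 add0r mulf_eq0 (negbTE b50) expf_eq0 /= =>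
      /eqP->;
      rewrite eqxx.
  by rewrite expr0n /= mulr0 addr0 mulf_eq0 (negbTE b40) expf_eq0 /= => /eqP->;
    rewrite eqxx.
case: i => /=.
- have [y0|/chartT[s [P [M [_ on e]]]]] := eqVneq y 0; last first.
    by left; exists s, P, M.
  have [u0|/chartF[s [P [M [sE on e]]]]] := eqVneq u 0.
    by have := uy0 u0; rewrite y0 eqxx.
  by right; exists s, P, M; split=> //; rewrite sE y0 mulr0.
- have [u0|/chartF[s [P [M [_ on e]]]]] := eqVneq u 0; last first.
    by left; exists s, P, M.
  have [s [P [M [sE on e]]]] := chartT (uy0 u0).
  by right; exists s, P, M; split=> //; exact: sE.
Qed.

(** P and M are determined by s up to sign. *)
Let in_chart_finite i (rs : seq C) : finite_set (in_chart i (fun s => s \in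
  rs)).
Proof.
pose signs : seq (C * C) := [:: (1, 1); (1, -1); (-1, 1); (-1, -1)].
pose f s (e : C * C) := pt (chart i s (e.1 * sqrtC (cA i).[s]) (e.2 * sqrtC (cB
  i).[s])).
apply: (sub_finite_set _ (finite_seq [seq f s e | s <- rs, e <- signs])).
move=> p [s [P [M [srs [PA MB] ->]]]].
have sign (Q D : C) : Q ^+ 2 = D -> exists2 e : C, e \in [:: 1;
  -1] & Q = e * sqrtC D.
  move=> QD; have /eqP : Q ^+ 2 = sqrtC D ^+ 2 by rewrite sqrtCK.
  rewrite eqf_sqr => /orP[]/eqP->; first by exists 1; rewrite ?mul1r ?inE ?eqxx.
  by exists (-1); rewrite ?mulN1r ?inE ?eqxx ?orbT.
have [e1 h1 ->] := sign _ _ PA; have [e2 h2 ->] := sign _ _ MB.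
have mem : f s (e1, e2) \in [seq f s e | s <- rs, e <- signs].
  apply: allpairs_f => //.
  by move: h1 h2; rewrite !inE => /orP[]/eqP-> /orP[]/eqP->; rewrite eqxx ?orbT.
exact: mem.
Qed.

Let chart_biquadratic i (f : {mpoly C[5]}) :
  biquadratic (cA i) (cB i) (fun s P M => f.@[(chart i s P M) 0]).
Proof.
pose w k (s P M : C) : C := chart i s P M 0 k.
apply: (@biquadratic_meval _ (cA i) (cB i) 5 f w) => k; rewrite /w /chart /vecj.
have zero : biquadratic (cA i) (cB i) (fun _ _ _ => 0).
  exists 0, 0, 0, 0 => s P M _; rewrite !horner0; ring.
have poly (p : {poly C}) := biquadratic_poly (cA i) (cB i) p.
have lin (d e : C) : biquadratic (cA i) (cB i) (fun _ P M => (P + d * M) / e).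
  exists 0, (e^-1)%:P, (d / e)%:P, 0 => s P M _; rewrite !horner0 !hornerC;
    ring.
case: k => [[|[|[|[|[|k]]]]] klt] //.
- by case: j; [apply: (biquadratic_eq zero) |
    apply: (biquadratic_eq (poly (chartU C i)))] => s P M; rewrite mxE.
- by case: j; [apply: (biquadratic_eq (poly (chartU C i))) |
    apply: (biquadratic_eq zero)] => s P M; rewrite mxE.
- by apply: (biquadratic_eq (lin 1 (2 * r4))) => s P M; rewrite mxE mul1r.
- by apply: (biquadratic_eq (poly (chartY C i))) => s P M; rewrite mxE.
- by apply: (biquadratic_eq (lin (-1) (2 * r5))) => s P M; rewrite mxE mulN1r.
Qed.

Lemma poly_roots_seq (N : {poly C}) : N != 0 ->
  exists rs : seq C, forall s, root N s -> s \in rs.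
Proof.
have [rs e] := closed_field_poly_normal N; move=> N0; exists rs => s.
by rewrite e rootZ ?lead_coef_eq0 // root_prod_XsubC.
Qed.

(** If f does not vanish identically on one chart, its zeros there are finitely
    many, and that chart misses only finitely many points of the curve. *)
Let curve_zeros (f : {mpoly C[5]}) d : whomog f d ->
  (forall p, curveY p -> f.@[coords p] = 0) \/
  finite_set (curveY `&` [set p | f.@[coords p] = 0]).
Proof.
move=> hf.
have finite_of i (N : {poly C}) : N != 0 ->
    (forall s P M, on_cover (cA i) (cB i) s P M ->
       f.@[(chart i s P M) 0] = 0 -> root N s) ->
    finite_set (curveY `&` [set p | f.@[coords p] = 0]).
  move=> /poly_roots_seq[rs rsP] zN.
  apply: (sub_finite_set _ (_ : finite_set
    (in_chart i (fun s => s \in rs) `|` in_chart (~~ i) (fun s => s \in [::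
      0])))).
    move=> p [/(curve_charts i)[|] [s [P [M [sP on e]]]] fp].
      left; exists s, P, M; split=> //; apply/rsP/(zN _ _ _ on)/eqP.
      by rewrite -(whomog_pt hf (chart_neq0 _ _ _ _)) -e; exact/eqP.
    by right; exists s, P, M; split=> //; rewrite sP inE.
  by rewrite finite_setU; split; exact: in_chart_finite.
have zeros i : (forall s P M, on_cover (cA i) (cB i) s P M ->
    f.@[(chart i s P M) 0] = 0) \/
    finite_set (curveY `&` [set p | f.@[coords p] = 0]).
  have [nA nB nAB] := cover_nonsquare i.
  have [|[N N0 zN]] := biquadratic_zeros nA nB nAB (chart_biquadratic i f).
    by left.
  by right; exact: finite_of zN.
have [zF|] := zeros false; last by right.
have [zT|] := zeros true; last by right.
left=> p /(curve_charts false)[] [s [P [M [_ on ->]]]]; apply/eqP.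
  by rewrite (whomog_pt hf (chart_neq0 _ _ _ _)) zF.
by rewrite (whomog_pt hf (chart_neq0 _ _ _ _)) zT.
Qed.

Lemma curve_dichotomy (K : set (wproj R)) :
  closed K -> curveY `<=` K \/ finite_set (curveY `&` K).
Proof.
move=> cK; have [|nsub] := pselect (curveY `<=` K); first by left.
right; have [p [Yp nKp]] : exists p, curveY p /\ ~ K p.
  by apply: contrapT => np; apply: nsub => p Yp; apply: contrapT => nK;
    apply: np; exists p.
have [f [d [hf fp fK]]] := closed_separate cK nKp.
have [zf|fin] := curve_zeros hf; first by rewrite zf ?eqxx in fp.
by apply: sub_finite_set fin => r [Yr Kr]; split=> //; exact: fK.
Qed.

Definition curveX : set (wprojS R) := \pi_(wprojS R) @` curveY.

(** The square of y2 / u^4 is invariant under sigma, so the points with u = 1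
    and y2 a natural number have different images. *)
Lemma curveX_infinite : infinite_set curveX.
Proof.
pose P n := sqrtC (cA false).[n%:R]; pose M n := sqrtC (cB false).[n%:R].
have on n : on_cover (cA false) (cB false) n%:R (P n) (M n).
  by split; exact: sqrtCK.
pose g n := \pi_(wprojS R) (pt (chart false n%:R (P n) (M n))).
have inj_g : injective g.
  move=> n m /q5_eq; case; try exact: chart_neq0.
  move=> k [l [l0 [e0 e1 _ e3 _]]]; move: e0 e1 e3.
  rewrite /chartU /chartY /= !hornerC !hornerX => e0 e1 e3.
  have l8 : l ^+ 8 = 1.
    have e8 : (eps R ^+ k) ^+ 8 = 1 by rewrite exprAC eps8 expr1n.
    have [le|le] : l * eps R ^+ k = 1 \/ l * (eps R ^+ k) ^+ 3 = 1.
        by case: j e0 e1 => e0 e1; [right|left]; rewrite ?mulr1 in e0 e1.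
      have : (l * eps R ^+ k) ^+ 8 = 1 by rewrite le expr1n.
      by rewrite exprMn e8 mulr1.
    have : (l * (eps R ^+ k) ^+ 3) ^+ 8 = 1 by rewrite le expr1n.
    by rewrite exprMn (exprAC (eps R ^+ k)) e8 expr1n mulr1.
  have : (m%:R : C) ^+ 2 = n%:R ^+ 2.
    by rewrite e3 exprMn -exprM l8 mul1r.
  move/eqP; rewrite -!natrX eqr_nat eqn_exp2r // => /eqP->//.
move=> fin; apply: infinite_nat.
have := finite_preimage (in2W inj_g : {in g @^-1` curveX &, injective g}) fin.
apply: sub_finite_set => n _.
by exists (pt (chart false n%:R (P n) (M n))) => //; exact: chart_on.
Qed.

End FixedCurve.

(** * The fixed locus *)

Section FixedLocus.
Variable R : realType.
Local Notation C := R[i].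
Variables a b : 'rV[C]_6.

Definition fixed_curveY (j : bool) : set (wproj R) :=
  curveY j (if j then a 0 2 else a 0 0) (if j then b 0 3 else b 0 2)
    (a 0 4) (a 0 5) (b 0 4) (b 0 5).

Definition fixed_curve (j : bool) : set (wprojS R) :=
  \pi_(wprojS R) @` fixed_curveY j.

Lemma surfY_ptj j (u x y z : C) : vecj j u x y z != 0 ->
  surfY a b (ptj j u x y z) <->
  curve_eqs (if j then a 0 2 else a 0 0) (if j then b 0 3 else b 0 2)
    (a 0 4) (a 0 5) (b 0 4) (b 0 5) u x y z.
Proof.
move=> v0; rewrite /ptj surfY_pt // q0E q2E /curve_eqs.
by case: j v0 => v0; rewrite !mxE /= !expr0n /=;
  apply: and_iff; apply: eq0_iff; ring.
Qed.

Lemma fixed_curveYE j :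
  fixed_curveY j = surfY a b `&` [set p | coords p (if j then 0 else 1) = 0].
Proof.
have zero (v : 'rV[C]_5) k : v != 0 -> coords (pt v) k = 0 <-> v 0 k = 0.
  move=> v0; have := whomog_pt (@whomogXU R k) v0; rewrite !mevalXU => e.
  by split=> /eqP h; apply/eqP; rewrite ?e // -e.
apply/seteqP; split=> p.
  move=> [u [x [y [z [v0 eqs ->]]]]]; split; first exact/surfY_ptj.
  by apply/zero => //; case: j {v0 eqs}; rewrite mxE.
have [x0 [x1 [x2 [x3 [x4 [v0 ->]]]]]] := pt5P p.
case=> Y /= /(zero _ _ v0) xj.
exists (if j then x1 else x0), x2, x3, x4.
have e : vec5 x0 x1 x2 x3 x4 = vecj j (if j then x1 else x0) x2 x3 x4.
  by case: j xj; rewrite mxE /= => ->.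
rewrite /pt5 e in Y v0 *; split=> //.
exact/surfY_ptj.
Qed.

Let whomog_u1 : whomog (u1 R) 1 := @whomogXU R 0.
Let whomog_u3 : whomog (u3 R) 1 := @whomogXU R 1.
Let whomog_y1 : whomog (y1 R) 4 := @whomogXU R 2.
Let whomog_y2 : whomog (y2 R) 4 := @whomogXU R 3.
Let whomog_y3 : whomog (y3 R) 4 := @whomogXU R 4.

Lemma whomog_q0 : whomog (q0 a) 8.
Proof.
have hu1 n := whomogX (n := n) whomog_u1; have hu3 n := whomogX (n :=
  n) whomog_u3.
rewrite /q0; do !apply: whomogD; apply: whomogZ.
- exact: (hu1 8%N).
- exact: (whomogM (hu1 4%N) (hu3 4%N)).
- exact: (hu3 8%N).
- exact: (whomogM (whomogM (hu1 2%N) (hu3 2%N)) whomog_y2).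
- exact: (whomogX (n := 2) whomog_y2).
- exact: (whomogM whomog_y1 whomog_y3).
Qed.

Lemma whomog_q2 : whomog (q2 b) 8.
Proof.
have hu1 n := whomogX (n := n) whomog_u1; have hu3 n := whomogX (n :=
  n) whomog_u3.
rewrite /q2; do !apply: whomogD; apply: whomogZ.
- exact: (whomogM (hu1 6%N) (hu3 2%N)).
- exact: (whomogM (hu1 2%N) (hu3 6%N)).
- exact: (whomogM (hu1 4%N) whomog_y2).
- exact: (whomogM (hu3 4%N) whomog_y2).
- exact: (whomogX (n := 2) whomog_y1).
- exact: (whomogX (n := 2) whomog_y3).
Qed.

Lemma closed_fixed_curveY j : closed (fixed_curveY j).
Proof.
rewrite fixed_curveYE; apply: closedI.
  exact: (closedI (closed_zeros whomog_q0) (closed_zeros whomog_q2)).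
have := closed_zeros (@whomogXU R (if j then 0 else 1)).
by under eq_set do rewrite mevalXU.
Qed.

Lemma fixed_curveY_sigma j p : fixed_curveY j p -> fixed_curveY j (sigma p).
Proof.
move=> Yp; have Ysp : surfY a b (sigma p).
  by apply/surfY_sigma; move: Yp; rewrite fixed_curveYE => -[].
move: Yp Ysp => [u [x [y [z [v0 _ ->]]]]].
rewrite /ptj /vecj [pt _]/(pt5 _ _ _ _ _) sigma_pt5 // => Y.
have w0 := sigma_vec5_neq0 (eps_neq0 R) v0.
set e := eps R in Y w0 *.
have E : vec5 (e * if j then 0 else u) (e ^+ 3 * if j then u else 0)
    (e ^+ 2 * x) y (e ^+ 6 * z) =
    vecj j ((if j then e ^+ 3 else e) * u) (e ^+ 2 * x) y (e ^+ 6 * z).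
  by case: j {v0 Y w0}; rewrite mulr0.
rewrite /pt5 E in Y w0 *.
exists ((if j then e ^+ 3 else e) * u), (e ^+ 2 * x), y, (e ^+ 6 * z).
by split=> //; exact/surfY_ptj.
Qed.

Lemma preimage_fixed_curve j :
  \pi_(wprojS R) @^-1` fixed_curve j = fixed_curveY j.
Proof.
apply/seteqP; split=> p; last by move=> Yp; exists p.
move=> [r Yr /wprojS_eqP[k ->]]; elim: k => //= k IH.
exact: fixed_curveY_sigma.
Qed.

Lemma closed_pi_preimage (K : set (wprojS R)) :
  closed (\pi_(wprojS R) @^-1` K) <-> closed K.
Proof. by rewrite -!openC wprojS_openE -wproj_openE preimage_setC. Qed.

Lemma fixed_curve_cofinite j :
  (if j then a 0 2 else a 0 0) != 0 -> (if j then b 0 3 else b 0 2) != 0 ->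
  a 0 4 != 0 -> a 0 5 != 0 -> b 0 4 != 0 -> b 0 5 != 0 ->
  (if j then b 0 3 else b 0 2) ^+ 2 * a 0 5 ^+ 2
    - 16 * b 0 4 * b 0 5 * (if j then a 0 2 else a 0 0) * a 0 4 != 0 ->
  cofinite_curve (fixed_curve j).
Proof.
move=> al0 be0 ga0 h0 b40 b50 disc; split.
- by apply/closed_pi_preimage; rewrite preimage_fixed_curve;
  exact: closed_fixed_curveY.
- exact: curveX_infinite.
- move=> K /closed_pi_preimage cK.
  have [sub|fin] := curve_dichotomy j al0 be0 ga0 h0 b40 b50 disc cK;
    [left|right].
    by move=> _ [p Yp <-]; exact: (sub p Yp).
  apply: sub_finite_set (finite_image \pi_(wprojS R) fin) => _ [[p Yp <-] Kp].
  by exists p.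
Qed.

(** The residual fixed points: there tau agrees with sigma^2. *)
Definition residual_fixed : set (wprojS R) :=
  [set x | exists u v y : C, [/\ vec5 u v 0 y 0 != 0,
     surfY a b (pt5 u v 0 y 0) & x = q5 u v 0 y 0]].

(** If tau p = sigma^k p, let l be the scalar relating the two representatives
    and e = eps^k.  When u1 and u3 are nonzero, l e and l e^3 are i and - i, so
    e^2 = - 1 and l^4 = 1; then y1 and y3 equal their opposites. *)
Lemma fixed_locusE :
  fixed_locus a b = fixed_curve false `|` fixed_curve true `|` residual_fixed.
Proof.
have i2 := sqr_Ci R; have i0 : 'i%C != 0 :> C.
  by rewrite eq_complex /= oner_eq0 andbF.
apply/seteqP; split=> x.
- move=> [[p]]; have [x0 [x1 [x2 [x3 [x4 [v0 ->]]]]]] := pt5P p.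
  move=> Yp <-; rewrite tauS_pi tau_pt5 // => /esym /q5_eq.
  case=> [//||k [l [l0 [e0 e1 e2 _ e4]]]]; first exact: tau_vec5_neq0.
  set e := eps R ^+ k in e0 e1 e2 e4.
  have e8 : e ^+ 8 = 1 by rewrite /e exprAC eps8 expr1n.
  have [x00|x00] := eqVneq x0 0.
    left; right; exists (pt5 x0 x1 x2 x3 x4) => //.
    rewrite fixed_curveYE; split=> //=.
    have := whomog_pt (@whomogXU R 0) v0; rewrite !mevalXU mxE /= x00 eqxx.
    by move/eqP.
  have [x10|x10] := eqVneq x1 0.
    left; left; exists (pt5 x0 x1 x2 x3 x4) => //.
    rewrite fixed_curveYE; split=> //=.
    have := whomog_pt (@whomogXU R 1) v0; rewrite !mevalXU mxE /= x10 eqxx.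
    by move/eqP.
  right.
  have E0 : 'i%C = l * e by apply: (mulIf x00); rewrite e0 mulrA.
  have E1 : - 'i%C = l * e ^+ 3 by apply: (mulIf x10); rewrite e1 mulrA.
  have E2 : e ^+ 2 = -1.
    apply: (mulfI i0); rewrite mulrN1 E1 E0; ring.
  have E4 : l ^+ 4 = 1.
    have : (l * e) ^+ 4 = 1 by rewrite -E0 (exprM _ 2 2) i2 sqrrN expr1n.
    by rewrite exprMn (exprM e 2 2) E2 sqrrN expr1n mulr1.
  have neg (t : C) : t = - t -> t = 0.
    by move=> /eqP; rewrite -addr_eq0 -mulr2n mulrn_eq0 => /eqP.
  have x20 : x2 = 0 by apply: neg; rewrite {1}e2 E4 E2 mul1r mulN1r.
  have x40 : x4 = 0.
    by apply: neg; rewrite {1}e4 E4 (exprM e 2 3) E2 mul1r -signr_odd mulN1r.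
  by rewrite x20 x40 in v0 Yp *; exists x0, x1, x3.
- have fixpt p : surfY a b p -> \pi_(wprojS R) p = tauS (\pi_(wprojS R) p) ->
    fixed_locus a b (\pi_(wprojS R) p) by move=> Yp tp; split=> //; exists p.
  have i4 : 'i%C ^+ 4 = 1 :> C by rewrite (exprM _ 2 2) i2 sqrrN expr1n.
  case=> [[|]|].
  + move=> [p [u [x' [y [z [v0 eqs ->]]]]] <-]; apply: fixpt;
    first exact/surfY_ptj.
    rewrite tauS_pi tau_pt5 //; congr (\pi _); apply/pt5_eq => //.
      exact: tau_vec5_neq0.
    by exists 'i%C => //=; rewrite i4 !mul1r !mulr0.
  + move=> [p [u [x' [y [z [v0 eqs ->]]]]] <-]; apply: fixpt;
    first exact/surfY_ptj.
    rewrite tauS_pi tau_pt5 //; congr (\pi _); apply/pt5_eq => //.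
      exact: tau_vec5_neq0.
    exists (- 'i%C); first by rewrite oppr_eq0.
    by rewrite /= -[X in X ^+ 4]mulN1r exprMn i4 -signr_odd !mul1r !mulr0.
  + move=> [u [v [y [v0 Yp ->]]]]; apply: fixpt => //.
    rewrite tauS_pi tau_pt5 //; apply/q5_eq => //; first exact: tau_vec5_neq0.
    exists 2%N, 1; rewrite /= eps2 expr1n !mul1r !mulr0; split;
      first exact: oner_neq0.
    by split=> //; rewrite exprS i2 mulrN1.
Qed.

End FixedLocus.

(** * The point where the two curves meet *)

Section BasePoint.
Variable R : realType.
Local Notation C := R[i].

Lemma Ci4 : 'i%C ^+ 4 = 1 :> C.
Proof. by rewrite (exprM _ 2 2) sqr_Ci sqrrN expr1n. Qed.

Lemma Ci_prim : 4.-primitive_root ('i%C : C).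
Proof.
have [m prim] := prim_order_exists (isT : (0 < 4)%N) Ci4.
have i2 : 'i%C ^+ 2 != 1 :> C.
  by rewrite sqr_Ci -subr_eq0 -opprD oppr_eq0 -(natrD _ 1 1) pnatr_eq0.
case: m prim => [|[|[|[|[|m]]]]] // prim _.
- by have := prim_expr_order prim; rewrite expr1 => i1;
  rewrite i1 expr1n eqxx in i2.
- by rewrite (prim_expr_order prim) eqxx in i2.
Qed.

Lemma unity4 (w : C) : w ^+ 4 = 1 -> exists m : 'I_4, w = 'i%C ^+ m.
Proof.
move=> w4; have [m ->] := prim_rootP Ci_prim w4.
by exists m.
Qed.

Variables a b : 'rV[C]_6.
Hypotheses (a4N0 : a 0 4 != 0) (a5N0 : a 0 5 != 0).
Hypotheses (b4N0 : b 0 4 != 0) (b5N0 : b 0 5 != 0).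

Lemma surfY_base (x y z : C) : vec5 0 0 x y z != 0 ->
  surfY a b (pt5 0 0 x y z) <->
  a 0 4 * y ^+ 2 + a 0 5 * (x * z) = 0 /\ b 0 4 * x ^+ 2 + b 0 5 * z ^+ 2 = 0.
Proof.
move=> v0; apply: (iff_trans (surfY_pt5 a b v0)).
by rewrite !expr0n /=; apply: and_iff; apply: eq0_iff; ring.
Qed.

Definition base_z : C := 4.-root (- (b 0 4 * a 0 4 ^+ 2) / (a 0 5 ^+ 2 * b 0
  5)).
Definition base_x : C := - a 0 4 / (a 0 5 * base_z).
Definition base_vec : 'rV[C]_5 := vec5 0 0 base_x 1 base_z.
Definition base_point : wprojS R := q5 0 0 base_x 1 base_z.

Lemma base_z4 : base_z ^+ 4 = - (b 0 4 * a 0 4 ^+ 2) / (a 0 5 ^+ 2 * b 0 5).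
Proof. exact: rootCK. Qed.

Lemma base_z_neq0 : base_z != 0.
Proof.
apply/eqP => z0; have /esym/eqP := base_z4; rewrite z0 expr0n /=.
rewrite mulf_eq0 oppr_eq0 invr_eq0 (mulf_eq0 (b 0 4)) (mulf_eq0 (_ ^+ 2) (b 0
  5)).
by rewrite !expf_eq0 /= (negbTE a4N0) (negbTE a5N0) (negbTE b4N0) (negbTE b5N0).
Qed.

Lemma base_x_neq0 : base_x != 0.
Proof. by rewrite mulf_neq0 ?oppr_eq0 // invr_eq0 mulf_neq0 // base_z_neq0. Qed.

Lemma base_vec_neq0 : base_vec != 0.
Proof. by rewrite vec5_neq0 oner_eq0 !orbT. Qed.

Lemma base_eqs : a 0 4 + a 0 5 * (base_x * base_z) = 0 /\
  b 0 4 * base_x ^+ 2 + b 0 5 * base_z ^+ 2 = 0.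
Proof.
have z0 := base_z_neq0; split; first by rewrite /base_x; field; rewrite z0.
transitivity ((b 0 4 * a 0 4 ^+ 2 / a 0 5 ^+ 2 + b 0 5 * base_z ^+ 4) / base_z
  ^+ 2).
  by rewrite /base_x; field; rewrite z0.
by rewrite base_z4; field; rewrite z0 a5N0 b5N0.
Qed.

Lemma surfY_base_point : surfY a b (pt base_vec).
Proof.
have [e0 e2] := base_eqs; apply/surfY_base; first exact: base_vec_neq0.
by rewrite expr1n mulr1.
Qed.

(** On the points of Y with u1 = u3 = 0, the ratio y3 / y2 determines the point
    and takes the four values of a fourth root; sigma multiplies it by a
    primitive fourth root of unity. *)
Lemma base_point_unique (x y z : C) : vec5 0 0 x y z != 0 ->
  surfY a b (pt5 0 0 x y z) -> q5 0 0 x y z = base_point.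
Proof.
move=> v0 /(surfY_base v0) [e0 e2].
have y0 : y != 0.
  apply: contraNneq v0 => y0; rewrite -[_ == 0]negbK vec5_neq0 eqxx /=.
  move: e0 e2; rewrite y0 expr0n mulr0 add0r => /eqP.
  rewrite mulf_eq0 (negbTE a5N0) mulf_eq0 /= => /orP[]/eqP-> /eqP.
    by rewrite expr0n /= mulr0 add0r mulf_eq0 (negbTE b5N0) expf_eq0 /= =>
      /eqP->;
      rewrite eqxx.
  by rewrite expr0n /= mulr0 addr0 mulf_eq0 (negbTE b4N0) expf_eq0 /= => /eqP->;
    rewrite eqxx.
have x0 : x != 0.
  apply: contra_neq y0 => x0; move/eqP: e0.
  by rewrite x0 mul0r mulr0 addr0 mulf_eq0 (negbTE a4N0) expf_eq0 => /eqP.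
have z0 : z != 0.
  apply: contra_neq y0 => z0; move/eqP: e0.
  by rewrite z0 mulr0 mulr0 addr0 mulf_eq0 (negbTE a4N0) expf_eq0 => /eqP.
have zx : x / y = - a 0 4 / (a 0 5 * (z / y)).
  apply/eqP; rewrite -subr_eq0; apply/eqP.
  transitivity ((a 0 4 * y ^+ 2 + a 0 5 * (x * z)) / (a 0 5 * z * y)).
    by field; rewrite y0 z0 a5N0.
  by rewrite e0 mul0r.
have z4 : (z / y) ^+ 4 = base_z ^+ 4.
  rewrite base_z4; apply/eqP; rewrite -subr_eq0; apply/eqP.
  transitivity ((b 0 4 * (x / y) ^+ 2 + b 0 5 * (z / y) ^+ 2) * (z / y) ^+ 2 /
    b 0 5).
    by rewrite zx; field; rewrite y0 z0 a5N0 b5N0.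
  rewrite (_ : _ + _ = (b 0 4 * x ^+ 2 + b 0 5 * z ^+ 2) / y ^+ 2).
    by rewrite e2 !mul0r.
  by field.
pose w := base_z / (z / y).
have zy0 : z / y != 0 by rewrite mulf_neq0 ?invr_eq0.
have w4 : w ^+ 4 = 1 by rewrite expr_div_n -z4 divff // expf_neq0.
have w0 : w != 0 by rewrite mulf_neq0 ?base_z_neq0 ?invr_eq0.
have [m wE] := unity4 w4.
pose l := 4.-root y^-1; have l4 : l ^+ 4 = y^-1 by exact: rootCK.
have l0 : l != 0.
  by have := expf_eq0 l 4; rewrite l4 invr_eq0 (negbTE y0) /= => <-.
apply/q5_eq => //; first exact: base_vec_neq0.
(* sigma^k acts on z / y by i^(3k), and i^9 = i. *)
exists (3 * m)%N, l; rewrite /= l4 mulVf //; split=> //.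
have eE : eps R ^+ (3 * m) ^+ 2 = w ^+ 3.
  by rewrite wE -eps2 -!exprM; congr (_ ^+ _); rewrite mulnC (mulnC 3).
have eE6 : eps R ^+ (3 * m) ^+ 6 = w.
  by rewrite (exprM _ 2 3) eE -exprM (exprD _ 4 5) (exprD _ 4 1) w4 !mul1r
    expr1.
split; rewrite ?mulr0 //; last first.
  by rewrite eE6 /w; field; rewrite y0 z0.
rewrite eE; transitivity ((x / y) / w * w ^+ 4); last first.
  by field; rewrite y0 w0.
rewrite w4 mulr1 zx /base_x /w.
by field; rewrite y0 z0 a5N0 base_z_neq0.
Qed.

Lemma fixed_curvesI :
  fixed_curve a b false `&` fixed_curve a b true = [set base_point].
Proof.
apply/seteqP; split=> x.
- move=> [[p Yp <-] [r Yr /esym rp]].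
  have {rp} : fixed_curve a b true (\pi_(wprojS R) p) by rewrite rp; exists r.
  rewrite -[fixed_curve _ _ _ _]/((\pi_(wprojS R) @^-1` fixed_curve a b true)
    p).
  rewrite preimage_fixed_curve; move: Yp;
    rewrite !fixed_curveYE /= => -[Yp p1] [_ p0].
  have [x0 [x1 [x2 [x3 [x4 [v0 pE]]]]]] := pt5P p.
  have := whomog_pt (@whomogXU R 0) v0;
    rewrite -/(pt5 _ _ _ _ _) -pE !mevalXU p0 mxE /= eqxx.
  have := whomog_pt (@whomogXU R 1) v0;
    rewrite -/(pt5 _ _ _ _ _) -pE !mevalXU p1 mxE /= eqxx.
  move=> /esym/eqP x10 /esym/eqP x00; rewrite x10 x00 in v0 pE.
  by rewrite /= pE; apply: base_point_unique; rewrite -?pE.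
- move=> ->; split; exists (pt base_vec) => //; rewrite fixed_curveYE; split;
    try exact: surfY_base_point; apply/eqP.
  + have := whomog_pt (@whomogXU R 1) base_vec_neq0.
    by rewrite !mevalXU mxE /= eqxx.
  + have := whomog_pt (@whomogXU R 0) base_vec_neq0.
    by rewrite !mevalXU mxE /= eqxx.
Qed.

End BasePoint.

(** * The 1/4(1,1) point *)

Section QuarterPoints.
Variable R : realType.
Local Notation C := R[i].

Lemma meval_mderivX (n : nat) (f : {mpoly C[5]}) (j : 'I_5) (w : 'I_5 -> C) :
  ((f ^+ n)^`M(j)).@[w] = n%:R * f.@[w] ^+ n.-1 * (f^`M(j)).@[w].
Proof.
elim: n => [|n IH]; first by rewrite expr0 -mpolyC1 mderivC meval0 !mul0r.
rewrite exprS mderivM mevalD !mevalM IH meval_exp.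
case: n {IH} => [|n]; first by rewrite /= !expr0; ring.
by rewrite /= exprS; ring.
Qed.

Lemma meval_mderivXU (i j : 'I_5) (w : 'I_5 -> C) :
  (('X_i : {mpoly C[5]})^`M(j)).@[w] = (i == j)%:R.
Proof.
rewrite mderivX mnm1E mevalZ.
case: eqP => [->|_]; last by rewrite mul0r.
rewrite (_ : (U_(j) - U_(j))%MM = 0%MM) ?mpolyX0 ?meval1 ?mulr1 //.
by apply/mnmP => k; rewrite mnmBE subnn mnm0E.
Qed.

Lemma meval_mderivM (f g : {mpoly C[5]}) (j : 'I_5) (w : 'I_5 -> C) :
  ((f * g)^`M(j)).@[w] = (f^`M(j)).@[w] * g.@[w] + f.@[w] * (g^`M(j)).@[w].
Proof. by rewrite mderivM mevalD !mevalM. Qed.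

Lemma meval_mderivZXX c (i k j : 'I_5) m n (w : 'I_5 -> C) :
  ((c *: ('X_i ^+ m * 'X_k ^+ n))^`M(j)).@[w] =
  c * (m%:R * w i ^+ m.-1 * (i == j)%:R * w k ^+ n
       + w i ^+ m * (n%:R * w k ^+ n.-1 * (k == j)%:R)).
Proof.
rewrite mderivZ mevalZ (meval_mderivM ('X_i ^+ m)) !meval_mderivX.
by rewrite !meval_mderivXU !meval_exp !mevalXU.
Qed.

Lemma meval_mderivZXX1 c (i k j : 'I_5) m (w : 'I_5 -> C) :
  ((c *: ('X_i ^+ m * 'X_k))^`M(j)).@[w] =
  c * (m%:R * w i ^+ m.-1 * (i == j)%:R * w k + w i ^+ m * (k == j)%:R).
Proof.
rewrite mderivZ mevalZ (meval_mderivM ('X_i ^+ m)) !meval_mderivX.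
by rewrite !meval_mderivXU !meval_exp !mevalXU.
Qed.

Lemma meval_mderivZX1X1 c (i k j : 'I_5) (w : 'I_5 -> C) :
  ((c *: ('X_i * 'X_k))^`M(j)).@[w] = c * ((i == j)%:R * w k + w i * (k ==
    j)%:R).
Proof.
by rewrite mderivZ mevalZ (meval_mderivM 'X_i) !meval_mderivXU !mevalXU.
Qed.

Lemma meval_mderivZX c (i j : 'I_5) m (w : 'I_5 -> C) :
  ((c *: 'X_i ^+ m)^`M(j)).@[w] = c * (m%:R * w i ^+ m.-1 * (i == j)%:R).
Proof.
by rewrite mderivZ mevalZ !meval_mderivX !meval_mderivXU mevalXU.
Qed.

Lemma meval_mderivZXXX1 c (i k h j : 'I_5) m n (w : 'I_5 -> C) :
  ((c *: ('X_i ^+ m * 'X_k ^+ n * 'X_h))^`M(j)).@[w] =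
  c * ((m%:R * w i ^+ m.-1 * (i == j)%:R * w k ^+ n
        + w i ^+ m * (n%:R * w k ^+ n.-1 * (k == j)%:R)) * w h
       + w i ^+ m * w k ^+ n * (h == j)%:R).
Proof.
rewrite mderivZ mevalZ (meval_mderivM ('X_i ^+ m * 'X_k ^+ n)).
rewrite (meval_mderivM ('X_i ^+ m)) !meval_mderivX !meval_mderivXU.
by rewrite (mevalM _ ('X_i ^+ m)) !meval_exp !mevalXU.
Qed.

Lemma meval_mderiv_sum6 (A B D E F G : {mpoly C[5]}) j (w : 'I_5 -> C) :
  ((A + B + D + E + F + G)^`M(j)).@[w] =
  (A^`M(j)).@[w] + (B^`M(j)).@[w] + (D^`M(j)).@[w] + (E^`M(j)).@[w]
  + (F^`M(j)).@[w] + (G^`M(j)).@[w].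
Proof. by rewrite !mderivD !mevalD. Qed.

Lemma q0_deriv (a : 'rV[C]_6) (j : 'I_5) (w : 'I_5 -> C) :
  let D k : C := ((k : 'I_5) == j)%:R in
  ((q0 a)^`M(j)).@[w] =
  a 0 0 * (8%:R * w 0 ^+ 7 * D 0)
  + a 0 1 * (4%:R * w 0 ^+ 3 * D 0 * w 1 ^+ 4 + w 0 ^+ 4 * (4%:R * w 1 ^+ 3 * D
    1))
  + a 0 2 * (8%:R * w 1 ^+ 7 * D 1)
  + a 0 3 * ((2%:R * w 0 ^+ 1 * D 0 * w 1 ^+ 2
              + w 0 ^+ 2 * (2%:R * w 1 ^+ 1 * D 1)) * w 3
             + w 0 ^+ 2 * w 1 ^+ 2 * D 3)
  + a 0 4 * (2%:R * w 3 ^+ 1 * D 3) + a 0 5 * (D 2 * w 4 + w 2 * D 4).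
Proof.
rewrite /q0 meval_mderiv_sum6; congr (_ + _ + _ + _ + _ + _);
  [exact: meval_mderivZX | exact: meval_mderivZXX | exact: meval_mderivZX |
   exact: meval_mderivZXXX1 | exact: meval_mderivZX | exact: meval_mderivZX1X1].
Qed.

Lemma q2_deriv (b : 'rV[C]_6) (j : 'I_5) (w : 'I_5 -> C) :
  let D k : C := ((k : 'I_5) == j)%:R in
  ((q2 b)^`M(j)).@[w] =
  b 0 0 * (6%:R * w 0 ^+ 5 * D 0 * w 1 ^+ 2 + w 0 ^+ 6 * (2%:R * w 1 ^+ 1 * D
    1))
  + b 0 1 * (2%:R * w 0 ^+ 1 * D 0 * w 1 ^+ 6 + w 0 ^+ 2 * (6%:R * w 1 ^+ 5 * D
    1))
  + b 0 2 * (4%:R * w 0 ^+ 3 * D 0 * w 3 + w 0 ^+ 4 * D 3)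
  + b 0 3 * (4%:R * w 1 ^+ 3 * D 1 * w 3 + w 1 ^+ 4 * D 3)
  + b 0 4 * (2%:R * w 2 ^+ 1 * D 2) + b 0 5 * (2%:R * w 4 ^+ 1 * D 4).
Proof.
rewrite /q2 meval_mderiv_sum6; congr (_ + _ + _ + _ + _ + _);
  [exact: meval_mderivZXX | exact: meval_mderivZXX | exact: meval_mderivZXX1 |
   exact: meval_mderivZXX1 | exact: meval_mderivZX | exact: meval_mderivZX].
Qed.

Lemma jacobian_base (a b : 'rV[C]_6) (x y z : C) :
  jacobian a b (vec5 0 0 x y z) = \matrix_(j, k)
    [:: 0; 0; if k == 0 then a 0 5 * z else 2 * b 0 4 * x;
        if k == 0 then 2 * a 0 4 * y else 0;
        if k == 0 then a 0 5 * x else 2 * b 0 5 * z]`_j.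
Proof.
apply/matrixP => j k; rewrite [LHS]mxE [RHS]mxE; case: ifP => _.
- rewrite q0_deriv !mxE /=.
  by case: j => [[|[|[|[|[|j]]]]] jlt] //=; ring.
- rewrite q2_deriv !mxE /=.
  by case: j => [[|[|[|[|[|j]]]]] jlt] //=; ring.
Qed.

Lemma sigma_mxX k : sigma_mx R ^+ k = 
  diag_mx (vec5 (eps R ^+ k) (eps R ^+ k ^+ 3) (eps R ^+ k ^+ 2) 1 (eps R ^+ k
    ^+ 6)).
Proof.
have e6 : eps R ^+ 6 = - 'i%C by rewrite (exprD _ 4 2) eps4 eps2 mulN1r.
have s1 : sigma_mx R = diag_mx (vec5 (eps R) (eps R ^+ 3) (eps R ^+ 2) 1 (eps R
  ^+ 6)).
  by rewrite e6 eps2.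
elim: k => [|k IH].
  rewrite !expr0 !expr1n -[1]/(1%:M : 'M_5) -diag_const_mx; congr diag_mx.
  by apply/rowP; case=> [[|[|[|[|[|j]]]]] jlt] //; rewrite !mxE.
rewrite exprS IH s1 -[_ * _]/(_ *m _) mulmx_diag; congr diag_mx.
apply/rowP; case=> [[|[|[|[|[|j]]]]] jlt] //; rewrite !mxE /=
  ?(exprS (eps R) k); ring.
Qed.

Lemma torus_sigma (l : C) k : torus l *m sigma_mx R ^+ k =
  let e := eps R ^+ k in diag_mx (vec5 (l * e) (l * e ^+ 3)
    (l ^+ 4 * e ^+ 2) (l ^+ 4) (l ^+ 4 * e ^+ 6)).
Proof.
rewrite sigma_mxX torusE mulmx_diag; congr diag_mx.
by apply/rowP; case=> [[|[|[|[|[|j]]]]] jlt] //; rewrite !mxE /= ?mulr1.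
Qed.

Variables a b : 'rV[C]_6.
Hypotheses (a4N0 : a 0 4 != 0) (a5N0 : a 0 5 != 0).
Hypotheses (b4N0 : b 0 4 != 0) (b5N0 : b 0 5 != 0).
Hypotheses (a0N0 : a 0 0 != 0) (a2N0 : a 0 2 != 0).

Let v := base_vec a b.
Let x := base_x a b.
Let z := base_z a b.
Let x0 : x != 0. Proof. exact: base_x_neq0. Qed.
Let z0 : z != 0. Proof. exact: base_z_neq0. Qed.
Let two0 : (2 : C) != 0. Proof. by rewrite pnatr_eq0. Qed.

Let rank_base : \rank (jacobian a b v) = 2%N.
Proof.
rewrite -mxrank_tr; apply/eqP; apply: inj_row_free => u uJ.
have col j : \sum_k u 0 k * jacobian a b v j k = 0.
  have /rowP/(_ j) := uJ; rewrite mxE [RHS]mxE => e; rewrite -[RHS]e.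
  by apply: eq_bigr => k _; rewrite [X in _ = _ * X]mxE.
have c3 := col 3; have c2 := col 2.
rewrite !big_ord_recl !big_ord0 jacobian_base !mxE /= -/x -/z in c2 c3.
have i1 : lift ord0 (ord0 : 'I_1) = 1 :> 'I_2 by exact: val_inj.
rewrite i1 in c2 c3.
have u0 : u 0 0 = 0.
  have K : 2 * a 0 4 != 0 by exact: mulf_neq0.
  by apply: (mulIf K); rewrite mul0r -[RHS]c3; ring.
have u1 : u 0 1 = 0.
  have K : 2 * b 0 4 * x != 0 := mulf_neq0 (mulf_neq0 two0 b4N0) x0.
  by apply: (mulIf K); rewrite mul0r -[RHS]c2 (_ : ord0 = 0) // u0; ring.
apply/rowP => k; rewrite [RHS]mxE; case: k => [[|[|k]] klt] //.
- by rewrite -[RHS]u0; congr (u _ _); exact: val_inj.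
- by rewrite -[RHS]u1; congr (u _ _); exact: val_inj.
Qed.

(** In the directions y1, y2, y3 the tangent space of the cone is the line of
    the vector itself, which is also the direction of the torus orbit. *)
Let tangent_base (t : 'rV[C]_5) : t *m jacobian a b v = 0 ->
  t 0 2 = x * t 0 3 /\ t 0 4 = z * t 0 3.
Proof.
have [e0 e2] := base_eqs a4N0 a5N0 b4N0 b5N0; rewrite -/x -/z in e0 e2.
move=> tJ.
have row k : \sum_j t 0 j * jacobian a b v j k = 0.
  by have /rowP/(_ k) := tJ; rewrite mxE [RHS]mxE.
have c0 := row 0; have c1 := row 1.
rewrite !big_ord_recl !big_ord0 jacobian_base !mxE /= -/x -/z in c0 c1.
have i0 : lift ord0 (lift ord0 (ord0 : 'I_3)) = 2 :> 'I_5 by exact: val_inj.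
have i1 : lift ord0 (lift ord0 (lift ord0 (ord0 : 'I_2))) = 3 :> 'I_5 by exact:
  val_inj.
have i2 : lift ord0 (lift ord0 (lift ord0 (lift ord0 (ord0 : 'I_1)))) = 4 :>
  'I_5.
  exact: val_inj.
rewrite i0 i1 i2 in c0 c1.
move: c0 c1; set t2 := t 0 2; set t3 := t 0 3; set t4 := t 0 4 => c0 c1.
have {}c0 : a 0 5 * z * t2 + 2 * a 0 4 * t3 + a 0 5 * x * t4 = 0.
  by rewrite -[RHS]c0; ring.
have {}c1 : b 0 4 * x * t2 + b 0 5 * z * t4 = 0.
  by apply: (mulfI two0); rewrite mulr0 -[RHS]c1; ring.
have t2E : t2 = x * t3.
  have K : 2 * a 0 5 * b 0 5 * z ^+ 2 != 0.
    exact: mulf_neq0 (mulf_neq0 (mulf_neq0 two0 a5N0) b5N0) (expf_neq0 2 z0).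
  apply: (mulfI K); apply/eqP; rewrite -subr_eq0; apply/eqP.
  transitivity (b 0 5 * z * (a 0 5 * z * t2 + 2 * a 0 4 * t3 + a 0 5 * x * t4)
    - a 0 5 * x * (b 0 4 * x * t2 + b 0 5 * z * t4)
    - 2 * b 0 5 * z * t3 * (a 0 4 + a 0 5 * (x * z))
    + a 0 5 * t2 * (b 0 4 * x ^+ 2 + b 0 5 * z ^+ 2)); first by ring.
  by rewrite c0 c1 e0 e2; ring.
split=> //; have K : b 0 5 * z != 0 := mulf_neq0 b5N0 z0.
apply: (mulfI K); apply/eqP; rewrite -subr_eq0; apply/eqP.
transitivity ((b 0 4 * x * t2 + b 0 5 * z * t4) - b 0 4 * x * (t2 - x * t3)
    - t3 * (b 0 4 * x ^+ 2 + b 0 5 * z ^+ 2)); first by ring.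
by rewrite c1 e2 t2E; ring.
Qed.

(** The coordinates y1, y2, y3 of the vector are all nonzero, so they force
    l^4 = 1 and eps^(2k) = 1. *)
Let stabilizer_base g : stabilizer v g <->
  exists2 l : C, l ^+ 4 = 1 & g = diag_mx (vec5 l l 1 1 1).
Proof.
split=> [[[l [k [l0 ->]]]]|[l l4 ->]].
  rewrite torus_sigma /= /v /base_vec vec5_diag => /vec5_eq[_ _ e2 e3 _].
  move: (eps R ^+ k) e2 => e; rewrite mul1r in e3; rewrite e3 mul1r => e2.
  have {}e2 : e ^+ 2 = 1 by apply: (mulfI x0); rewrite e2 mulr1.
  have e4 : e ^+ 4 = 1 by rewrite (exprM _ 2 2) e2 expr1n.
  exists (l * e); first by rewrite exprMn e3 e4 mulr1.
  by rewrite (exprM e 2 3) (exprD e 2 1) e2 !expr1n !mul1r expr1.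
have l0 : l != 0.
  by apply/eqP => l0; move/eqP: l4; rewrite l0 expr0n eq_sym oner_eq0.
split.
  exists l, 0%N; rewrite torus_sigma /= l4 expr0 !expr1n !mulr1.
  by split.
by rewrite /v /base_vec vec5_diag !mul0r !mulr1.
Qed.

Let quarter_base : quarter_point a b (base_point a b).
Proof.
split; first by exists (pt v) => //; exact: surfY_base_point.
have v0 : v != 0 by exact: base_vec_neq0.
exists (exist _ v v0 : punctured R); split=> //=.
- by rewrite /base_point /q5 -[pt5 _ _ _ _ _]/(pt v) -(pt_pi (exist _ v v0)).
- exists (fun g : 'M[C]_5 => g 0 0); split.
  + split.
    * by move=> g /stabilizer_base[l l4 ->]; rewrite /= !mxE.
    * move=> g g'; rewrite !inE => /stabilizer_base[l _ ->] /stabilizer_base[l'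
      _ ->].
      by rewrite !mxE /= !mulr1n => ->.
    * move=> l /= l4; exists (diag_mx (vec5 l l 1 1 1)); last by rewrite !mxE.
      by apply/stabilizer_base; exists l.
  + move=> g /stabilizer_base[l l4 ->] t /tangent_base[t2 t4].
    exists ((1 - l) / 4 * t 0 3); rewrite [t]vec5P vec5_diag t2 t4.
    have n4 : (4 : C) != 0 by rewrite pnatr_eq0.
    apply/rowP; case=> [[|[|[|[|[|j]]]]] jlt] //;
      rewrite !mxE /weight /= -/x -/z.
    * ring.
    * ring.
    * by field.
    * by field.
    * by field.
Qed.

(** Each stabilizing element is H f for a fourth root of unity f, so there are
    four of them only if every f occurs.  For w with u1 or u3 nonzero, H i will
    fix only the multiples of one basis vector, which give no point of Y. *)
Let stabilizer_small (w : 'rV[C]_5) (chi : 'M[C]_5 -> C) (H : C -> 'M[C]_5) :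
  set_bij (stabilizer w) [set t | t ^+ 4 = 1] chi ->
  (forall g, stabilizer w g -> exists2 f, f ^+ 4 = 1 & g = H f) ->
  stabilizer w (H 'i%C).
Proof.
move=> [_ _ chi_surj] stabH.
have /choice[m mP] : forall r : 'I_4, exists m : 'I_4,
    stabilizer w (H ('i%C ^+ m)) /\ chi (H ('i%C ^+ m)) = 'i%C ^+ r.
  move=> r; have [|g sg <-] := chi_surj ('i%C ^+ r).
    by rewrite /= exprAC Ci4 expr1n.
  have [f f4 gE] := stabH g sg; have [m mE] := unity4 f4.
  by exists m; rewrite -mE -gE.
have m_inj : injective m.
  move=> r r' e; have [_ c] := mP r; have [_ c'] := mP r'.
  move/eqP: c; rewrite e c' (eq_prim_root_expr (Ci_prim R)) !modn_small //.
  by move/eqP => /val_inj ->.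
have /codomP[r rE] := injF_onto m_inj 1.
by have [] := mP r; rewrite -rE expr1.
Qed.

Let quarter_unique (p : wprojS R) : quarter_point a b p -> p = base_point a b.
Proof.
move=> [pX [[w w0] [wp _ [chi [bij _]]]]]; rewrite /= in bij.
have pE : p = \pi_(wprojS R) (pt w) by rewrite -wp -(pt_pi (exist _ w w0)).
have wY : surfY a b (pt w).
  move: pX => [r rY]; rewrite pE => /wprojS_eqP[k ->].
  by elim: k => //= k IH; apply/surfY_sigma.
move: w0 wY bij pE {wp}; rewrite [w]vec5P.
move: (w 0 0) (w 0 1) (w 0 2) (w 0 3) (w 0 4) => w0 w1 w2 w3 w4 wN0 wY bij pE.
have e8 k : (eps R ^+ k) ^+ 8 = 1 by rewrite exprAC eps8 expr1n.
have i1 (t : C) : t = t * 'i%C -> t = 0.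
  move=> /eqP; rewrite -[X in X == _]mulr1 -subr_eq0 -mulrBr mulf_eq0 subr_eq0.
  case/orP => /eqP // i1; have := eq_prim_root_expr (Ci_prim R) 1 0.
  by rewrite expr1 expr0 -i1 eqxx.
have i2 (t : C) : t = t * 'i%C ^+ 2 -> t = 0.
  rewrite sqr_Ci mulrN1 => /eqP; rewrite -addr_eq0 -mulr2n mulrn_eq0.
  by move=> /eqP.
have i3 (t : C) : t = t * 'i%C ^+ 3 -> t = 0.
  move=> e; apply: i1; rewrite [in RHS]e -mulrA -exprSr Ci4 mulr1 //.
have [w00|w00] := eqVneq w0 0; last first.
  (* With l e = 1 all entries are powers of f = e^2, where f^4 = 1. *)
  pose H (f : C) := diag_mx (vec5 1 f (f ^+ 3) (f ^+ 2) f).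
  have stabH g : stabilizer (vec5 w0 w1 w2 w3 w4) g ->
      exists2 f, f ^+ 4 = 1 & g = H f.
    move=> [[l [k [l0 ->]]]]; rewrite torus_sigma /= vec5_diag => /vec5_eq[fix0
      _ _ _ _].
    have := e8 k; move: (eps R ^+ k) fix0 => e /(canRL (mulKf w00)) le e8'.
    rewrite mulVf // in le.
    have e0 : e != 0 by apply/eqP => e0; move/eqP: le;
      rewrite e0 mulr0 eq_sym oner_eq0.
    have -> : l = e ^+ 7 by apply: (mulIf e0); rewrite le -exprSr e8'.
    exists (e ^+ 2); first by rewrite -exprM e8'.
    by congr diag_mx; apply/vec5_eq; split; ring: e8'.
  have [_] := stabilizer_small bij stabH;
    rewrite vec5_diag => /vec5_eq[_ f1 f2 f3 f4].
  have w10 := i1 _ (esym f1); have w20 := i3 _ (esym f2).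
  have w30 := i2 _ (esym f3); have w40 := i1 _ (esym f4).
  move: wN0 wY; rewrite w10 w20 w30 w40 => wN0 /(surfY_pt5 a b wN0)[/eqP].
  rewrite !expr0n /= !(mulr0, addr0) mulf_eq0 (negbTE a0N0) expf_eq0 /=.
  by rewrite (negbTE w00).
have [w10|w10] := eqVneq w1 0; last first.
  (* Here l e^3 = 1 instead. *)
  pose H (f : C) := diag_mx (vec5 (f ^+ 3) 1 (f ^+ 3) (f ^+ 2) f).
  have stabH g : stabilizer (vec5 w0 w1 w2 w3 w4) g ->
      exists2 f, f ^+ 4 = 1 & g = H f.
    move=> [[l [k [l0 ->]]]]; rewrite torus_sigma /= vec5_diag => /vec5_eq[_
      fix1 _ _ _].
    have := e8 k; move: (eps R ^+ k) fix1 => e /(canRL (mulKf w10)) le e8'.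
    rewrite mulVf // in le.
    have e0 : e ^+ 3 != 0.
      by apply/eqP => e0; move/eqP: le; rewrite e0 mulr0 eq_sym oner_eq0.
    have -> : l = e ^+ 5 by apply: (mulIf e0); rewrite le -exprD e8'.
    exists (e ^+ 2); first by rewrite -exprM e8'.
    by congr diag_mx; apply/vec5_eq; split; ring: e8'.
  have [_] := stabilizer_small bij stabH;
    rewrite vec5_diag => /vec5_eq[_ _ f2 f3 f4].
  have w20 := i3 _ (esym f2); have w30 := i2 _ (esym f3).
  have w40 := i1 _ (esym f4).
  move: wN0 wY; rewrite w00 w20 w30 w40 => wN0 /(surfY_pt5 a b wN0)[/eqP].
  rewrite !expr0n /= !(mul0r, mulr0, addr0, add0r) mulf_eq0 (negbTE a2N0)
    expf_eq0 /=.
  by rewrite (negbTE w10).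
move: wN0 wY pE; rewrite w00 w10 => wN0 wY ->.
exact: base_point_unique.
Qed.

Lemma quarter_points : [set p | quarter_point a b p] = [set base_point a b].
Proof. by apply/seteqP; split=> [p /quarter_unique -> //|_ ->]. Qed.

End QuarterPoints.

(** * The isolated fixed points *)

Section Quartic.

Definition quartic (S : comNzRingType) (e : 'I_5 -> S) (t : S) : S :=
  e 4 * t ^+ 4 + e 3 * t ^+ 3 + e 2 * t ^+ 2 + e 1 * t + e 0.

Definition quartic_disc (S : comNzRingType) (f : 'I_5 -> S) : S :=
  let e := f 0 in let d := f 1 in let c := f 2 in let b := f 3 in let a :=
    f 4 in
  256 * a ^+ 3 * e ^+ 3 - 192 * a ^+ 2 * b * d * e ^+ 2
  - 128 * a ^+ 2 * c ^+ 2 * e ^+ 2 + 144 * a ^+ 2 * c * d ^+ 2 * e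
  - 27 * a ^+ 2 * d ^+ 4 + 144 * a * b ^+ 2 * c * e ^+ 2
  - 6 * a * b ^+ 2 * d ^+ 2 * e - 80 * a * b * c ^+ 2 * d * e
  + 18 * a * b * c * d ^+ 3 + 16 * a * c ^+ 4 * e
  - 4 * a * c ^+ 3 * d ^+ 2 - 27 * b ^+ 4 * e ^+ 2
  + 18 * b ^+ 3 * c * d * e - 4 * b ^+ 3 * d ^+ 3
  - 4 * b ^+ 2 * c ^+ 3 * e + b ^+ 2 * c ^+ 2 * d ^+ 2.

(** The two equations express the two lowest coefficients through t and the
    others, and the discriminant then vanishes identically. *)
Lemma quartic_disc_double (S : comNzRingType) (e : 'I_5 -> S) (t : S) :
  quartic e t = 0 ->
  4 * e 4 * t ^+ 3 + 3 * e 3 * t ^+ 2 + 2 * e 2 * t + e 1 = 0 ->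
  quartic_disc e = 0.
Proof.
rewrite /quartic /quartic_disc.
move: (e 0) (e 1) (e 2) (e 3) (e 4) => e0 e1 e2 e3 e4 r0 r1.
have e1E : e1 = - (4 * e4 * t ^+ 3 + 3 * e3 * t ^+ 2 + 2 * e2 * t).
  by apply/eqP; rewrite -addr_eq0 addrC r1.
have e0E : e0 = - (e4 * t ^+ 4 + e3 * t ^+ 3 + e2 * t ^+ 2 + e1 * t).
  by apply/eqP; rewrite -addr_eq0 addrC r0.
by rewrite /= e0E e1E; ring.
Qed.

Lemma quartic_roots (F : numClosedFieldType) (e : 'I_5 -> F) :
  e 4 != 0 -> quartic_disc e != 0 ->
  exists rs : seq F, [/\ size rs = 4%N, uniq rs &
    forall t, (t \in rs) = (quartic e t == 0)].
Proof.
move=> e40 disc.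
pose p : {poly F} := e 4 *: 'X^4 + e 3 *: 'X^3 + e 2 *: 'X^2 + e 1 *: 'X + (e
  0)%:P.
have pE : p = Poly [:: e 0; e 1; e 2; e 3; e 4].
  apply/polyP => k; rewrite coef_Poly /p !coefD !coefZ !coefXn coefX coefC.
  by case: k => [|[|[|[|[|k]]]]] /=; rewrite ?nth_nil; ring.
have ps : p = [:: e 0; e 1; e 2; e 3; e 4] :> seq F by rewrite pE (PolyK (c :=
  0)).
have horn t : p.[t] = quartic e t.
  by rewrite /p !hornerD !hornerZ !hornerXn hornerX hornerC.
have dhorn t : p^`().[t] = 4 * e 4 * t ^+ 3 + 3 * e 3 * t ^+ 2 + 2 * e 2 * t +
  e 1.
  rewrite /p !derivD !derivZ !derivXn derivX derivC addr0 !hornerD !hornerZ.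
  by rewrite !hornerMn !hornerXn hornerC /=; ring.
have lead : lead_coef p = e 4 by rewrite lead_coefE ps.
have [rs rsE] := closed_field_poly_normal p; rewrite lead in rsE.
have mem t : (t \in rs) = (quartic e t == 0).
  by rewrite -horn -/(root p t) rsE rootZ // root_prod_XsubC.
exists rs; split=> //.
  have := congr1 (size \o (@polyseq F)) rsE; rewrite /= ps size_scale //.
  by rewrite size_prod_XsubC => -[].
rewrite -separable_prod_XsubC unlock;
  apply: Pdiv.ClosedField.root_coprimep => t rt.
apply: contra_neqN disc => dt; apply: (@quartic_disc_double _ _ t).
  by apply/eqP; rewrite -mem -root_prod_XsubC.
by rewrite -dhorn rsE derivZ hornerZ (rootP dt) mulr0.
Qed.

End Quartic.

Section Residual.

(** Eliminating y2 between q2 and q0 on y1 = y3 = 0 leaves this quartic form in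
    (u1^4 : u3^4). *)
Definition residual_quartic (S : comNzRingType) (a b : 'I_6 -> S) : 'I_5 -> S :=
  fun k => [:: a 2 * b 3 ^+ 2;
    a 1 * b 3 ^+ 2 + 2 * a 2 * b 2 * b 3 - a 3 * b 1 * b 3 + a 4 * b 1 ^+ 2;
    a 0 * b 3 ^+ 2 + 2 * a 1 * b 2 * b 3 + a 2 * b 2 ^+ 2
      - a 3 * (b 0 * b 3 + b 1 * b 2) + 2 * a 4 * b 0 * b 1;
    2 * a 0 * b 2 * b 3 + a 1 * b 2 ^+ 2 - a 3 * b 0 * b 2 + a 4 * b 0 ^+ 2;
    a 0 * b 2 ^+ 2]`_k.

Lemma residual_quarticE (S : comNzRingType) (a b : 'I_6 -> S) t :
  quartic (residual_quartic a b) t =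
  (a 0 * t ^+ 2 + a 1 * t + a 2) * (b 2 * t + b 3) ^+ 2
  - a 3 * t * (b 0 * t + b 1) * (b 2 * t + b 3) + a 4 * t * (b 0 * t + b 1) ^+
    2.
Proof. by rewrite /quartic /residual_quartic /=; ring. Qed.

Variable R : realType.
Local Notation C := R[i].
Variables a b : 'rV[C]_6.
Hypotheses (a0N0 : a 0 0 != 0) (a2N0 : a 0 2 != 0) (a4N0 : a 0 4 != 0).
Hypotheses (b2N0 : b 0 2 != 0) (b3N0 : b 0 3 != 0).
Hypothesis b03N0 : b 0 0 * b 0 3 - b 0 1 * b 0 2 != 0.

Let quart (t : C) : C := quartic (residual_quartic (a 0) (b 0)) t.

Lemma surfY_residual (u v y : C) : vec5 u v 0 y 0 != 0 ->
  surfY a b (pt5 u v 0 y 0) <->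
  a 0 0 * u ^+ 8 + a 0 1 * (u ^+ 4 * v ^+ 4) + a 0 2 * v ^+ 8
    + a 0 3 * (u ^+ 2 * v ^+ 2 * y) + a 0 4 * y ^+ 2 = 0 /\
  u ^+ 2 * v ^+ 2 * (b 0 0 * u ^+ 4 + b 0 1 * v ^+ 4)
    + (b 0 2 * u ^+ 4 + b 0 3 * v ^+ 4) * y = 0.
Proof.
move=> v0; apply: (iff_trans (surfY_pt5 a b v0)).
by apply: and_iff; apply: eq0_iff; ring.
Qed.

(** If u or v vanishes, the two equations leave only the zero vector. *)
Lemma residual_neq0 (u v y : C) : vec5 u v 0 y 0 != 0 ->
  surfY a b (pt5 u v 0 y 0) -> u != 0 /\ v != 0.
Proof.
move=> nz /(surfY_residual nz) [e0 e2].
have vanish (s t w : C) : s != 0 -> t != 0 ->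
    s * w ^+ 8 + a 0 4 * y ^+ 2 = 0 -> t * (w ^+ 4 * y) = 0 -> w = 0 /\ y = 0.
  move=> s0 t0 h0 /eqP; rewrite mulf_eq0 (negbTE t0) mulf_eq0 expf_eq0 /=.
  case/orP => /eqP z; move/eqP: h0; rewrite z expr0n /= mulr0 ?add0r ?addr0.
    by rewrite mulf_eq0 (negbTE a4N0) expf_eq0 => /eqP.
  by rewrite mulf_eq0 (negbTE s0) expf_eq0 => /eqP.
split; apply: contraNneq nz => z0; rewrite -[_ == 0]negbK vec5_neq0.
- have h0 : a 0 2 * v ^+ 8 + a 0 4 * y ^+ 2 = 0 by rewrite -[RHS]e0 z0; ring.
  have h2 : b 0 3 * (v ^+ 4 * y) = 0 by rewrite -[RHS]e2 z0; ring.
  by have [-> ->] := vanish _ _ _ a2N0 b3N0 h0 h2; rewrite z0 eqxx.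
- have h0 : a 0 0 * u ^+ 8 + a 0 4 * y ^+ 2 = 0 by rewrite -[RHS]e0 z0; ring.
  have h2 : b 0 2 * (u ^+ 4 * y) = 0 by rewrite -[RHS]e2 z0; ring.
  by have [-> ->] := vanish _ _ _ a0N0 b2N0 h0 h2; rewrite z0 eqxx.
Qed.

(** A common root would annihilate the resultant b0 b3 - b1 b2. *)
Let den_neq0 t : b 0 2 * t + b 0 3 = 0 -> b 0 0 * t + b 0 1 != 0.
Proof.
move=> d; apply: contraNneq b03N0 => n.
rewrite (_ : _ - _ = b 0 0 * (b 0 2 * t + b 0 3) - b 0 2 * (b 0 0 * t + b 0 1)).
  by rewrite d n !mulr0 subrr.
by ring.
Qed.

(** The choice of the fourth root is immaterial: sigma multiplies u1 / u3 by a
    primitive fourth root of unity. *)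
Definition residual_point (t : C) : wprojS R :=
  q5 (4.-root t) 1 0
    (- (4.-root t ^+ 2 * (b 0 0 * t + b 0 1)) / (b 0 2 * t + b 0 3)) 0.

Let residual_vec_neq0 (u y : C) : vec5 u 1 0 y 0 != 0.
Proof. by rewrite vec5_neq0 oner_eq0 orbT. Qed.

Lemma residual_fixedE :
  residual_fixed a b = residual_point @` [set t | quart t = 0].
Proof.
apply/seteqP; split=> p.
- move=> [u [v [y [nz Y ->]]]]; have [u0 v0] := residual_neq0 nz Y.
  have [e0 e2] := (surfY_residual nz).1 Y.
  pose u' := u / v; pose t := u' ^+ 4; pose y' := y / v ^+ 4.
  have u'0 : u' != 0 by rewrite mulf_neq0 ?invr_eq0.
  have E2 : u' ^+ 2 * (b 0 0 * t + b 0 1) + (b 0 2 * t + b 0 3) * y' = 0.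
    by apply: (mulfI (expf_neq0 8 v0)); rewrite mulr0 -[RHS]e2 /y' /t /u';
      field.
  have E0 : a 0 0 * t ^+ 2 + a 0 1 * t + a 0 2 + a 0 3 * (u' ^+ 2 * y')
      + a 0 4 * y' ^+ 2 = 0.
    by apply: (mulfI (expf_neq0 8 v0)); rewrite mulr0 -[RHS]e0 /y' /t /u';
      field.
  have d0 : b 0 2 * t + b 0 3 != 0.
    apply/eqP => d; have := den_neq0 d; move/eqP: E2; rewrite d mul0r addr0.
    by rewrite mulf_eq0 expf_eq0 (negbTE u'0) /= => /eqP->; rewrite eqxx.
  have y'E : y' = - (u' ^+ 2 * (b 0 0 * t + b 0 1)) / (b 0 2 * t + b 0 3).
    apply: (mulfI d0); rewrite [RHS]mulrC divfK //; apply/eqP.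
    by rewrite -addr_eq0 addrC E2.
  exists t.
    rewrite /= /quart residual_quarticE.
    transitivity ((b 0 2 * t + b 0 3) ^+ 2 * (a 0 0 * t ^+ 2 + a 0 1 * t + a 0 2
        + a 0 3 * (u' ^+ 2 * y') + a 0 4 * y' ^+ 2)); last by rewrite E0 mulr0.
    rewrite y'E -[in a 0 3 * t](erefl : u' ^+ 4 = t).
    rewrite (_ : a 0 4 * t = a 0 4 * u' ^+ 4) //.
    by field.
  pose w := 4.-root t; have w4 : w ^+ 4 = t by exact: rootCK.
  have w0 : w != 0.
    by have := expf_eq0 w 4; rewrite w4 expf_eq0 (negbTE u'0) /= => <-.
  (* Both u' and w are fourth roots of t. *)
  have [m mE] : exists m : 'I_4, u' / w = 'i%C ^+ m.
    by apply: unity4; rewrite expr_div_n w4 divff // expf_neq0.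
  pose e := eps R ^+ m; have eE : e ^+ 2 = u' / w by rewrite /e exprAC eps2.
  have en0 : e != 0 by rewrite expf_neq0 ?eps_neq0.
  have ev0 : e ^+ 3 * v != 0 := mulf_neq0 (expf_neq0 3 en0) v0.
  apply/esym/q5_eq => //.
  exists m, (e ^+ 3 * v)^-1; rewrite -/e /=; split.
    by rewrite invr_eq0.
  split; rewrite ?mulr0 //.
  + transitivity (u' / e ^+ 2); last by rewrite /u'; field; rewrite v0 en0.
    by rewrite eE -/w; field; rewrite u'0 w0.
  + by rewrite mulVf.
  + transitivity (y' / e ^+ 2 ^+ 2 / (e ^+ 8)); last first.
      by rewrite /y'; field; rewrite v0 en0.
    rewrite {2}/e exprAC eps8 expr1n divr1 eE y'E -/w.
    by field; rewrite u'0 w0 d0.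
- move=> [t /= tr <-]; exists (4.-root t), 1.
  have d0 : b 0 2 * t + b 0 3 != 0.
    apply/eqP => d; have n0 := den_neq0 d; move/eqP: tr.
    rewrite /quart residual_quarticE d expr0n /= !mulr0 subr0 add0r.
    rewrite mulf_eq0 (negbTE (expf_neq0 2 n0)) orbF mulf_eq0 (negbTE a4N0) /=.
    move=> /eqP t0.
    by move/eqP: d; rewrite t0 mulr0 add0r (negbTE b3N0).
  exists (- (4.-root t ^+ 2 * (b 0 0 * t + b 0 1)) / (b 0 2 * t + b 0 3)).
  split=> //; apply/surfY_residual => //.
  move: tr; rewrite /quart residual_quarticE.
  have : 4.-root t ^+ 4 = t by exact: rootCK.
  move: (4.-root t) => w w4 tr; rewrite !expr1n !mulr1.
  have w8 : w ^+ 8 = t ^+ 2 by rewrite -w4 -exprM.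
  rewrite w8 w4; split; last by field.
  apply: (mulfI (expf_neq0 2 d0)); rewrite mulr0 -[RHS]tr.
  have sub4 : a 0 3 * t = a 0 3 * w ^+ 4 by rewrite w4.
  have sub4' : a 0 4 * t = a 0 4 * w ^+ 4 by rewrite w4.
  by rewrite sub4 sub4'; field.
Qed.

(** u1^4 / u3^4 is invariant under sigma and under the torus. *)
Lemma residual_point_inj : injective residual_point.
Proof.
move=> t t' /q5_eq[//|//|k [l [l0 [eu ev _ _ _]]]].
have e8 : (eps R ^+ k) ^+ 8 = 1 by rewrite exprAC eps8 expr1n.
move: (eps R ^+ k) e8 eu ev => e e8 eu; rewrite mulr1 => ev.
have : (l * e ^+ 3) ^+ 4 = 1 by rewrite -ev expr1n.
rewrite exprMn -exprM (exprD _ 8 4) e8 mul1r => le4.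
have := congr1 (fun w => w ^+ 4) eu; rewrite mulrA !exprMn le4 mul1r.
by rewrite !rootCK.
Qed.

Lemma residual_card : quartic_disc (residual_quartic (a 0) (b 0)) != 0 ->
  (residual_fixed a b #= `I_4)%card.
Proof.
move=> disc; have [|rs [rs4 rsU rsE]] := quartic_roots _ disc.
  by rewrite /residual_quartic /= mulf_neq0 // expf_neq0.
have -> : residual_fixed a b = (residual_point \o nth 0 rs) @` `I_4.
  rewrite residual_fixedE; apply/seteqP; split=> p.
    move=> [t /eqP]; rewrite -rsE -index_mem rs4 => lt <-.
    by exists (index t rs) => //=; rewrite nth_index // -index_mem rs4.
  move=> [k /= k4 <-]; exists (nth 0 rs k) => //.
  by apply/eqP; rewrite /= -rsE mem_nth // rs4.
apply: inj_card_eq => i k; rewrite !inE /= => i4 k4 /residual_point_inj/eqP.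
by rewrite nth_uniq ?rs4 // => /eqP.
Qed.

Lemma residual_disjoint :
  residual_fixed a b `&` (fixed_curve a b false `|` fixed_curve a b true) =
    set0.
Proof.
apply/seteqP; split=> // p [[u [v [y [nz Y ->]]]]].
have [u0 v0] := residual_neq0 nz Y.
have notin j : ~ fixed_curve a b j (q5 u v 0 y 0).
  rewrite -[fixed_curve _ _ _ _]/((\pi_(wprojS R) @^-1` fixed_curve a b j) _).
  rewrite preimage_fixed_curve fixed_curveYE => -[_ /= /eqP].
  have := whomog_pt (@whomogXU R (if j then 0 else 1)) nz.
  rewrite !mevalXU => ->; rewrite mxE.
  by case: j => /=; rewrite ?(negbTE u0) ?(negbTE v0).
by case=> /notin.
Qed.

End Residual.

(** * Genericity *)

Section Genericity.

(** The minor b0 b3 - b1 b2 allows y2 to be eliminated on y1 = y3 = 0; the next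
    two factors are the discriminants attached to the curves u3 = 0 and u1 = 0;
    the last one separates the isolated fixed points. *)
Definition generic_form (S : comNzRingType) (a b : 'I_6 -> S) : S :=
  a 0 * a 2 * a 4 * a 5 * (b 2 * b 3 * b 4 * b 5) * (b 0 * b 3 - b 1 * b 2)
  * (b 2 ^+ 2 * a 5 ^+ 2 - 16 * b 4 * b 5 * a 0 * a 4)
  * (b 3 ^+ 2 * a 5 ^+ 2 - 16 * b 4 * b 5 * a 2 * a 4)
  * quartic_disc (residual_quartic a b).

Section Morphism.
Variables (S T : comNzRingType) (f : {rmorphism S -> T}).

Let fE := (rmorphXn f, rmorphM f, rmorphD f, rmorphN f, rmorph_nat f).

Lemma quartic_disc_morph (e : 'I_5 -> S) :
  f (quartic_disc e) = quartic_disc (f \o e).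
Proof.
rewrite /quartic_disc /=; move: (e 0) (e 1) (e 2) (e 3) (e 4) => *.
by rewrite !fE.
Qed.

Lemma generic_form_morph (a b : 'I_6 -> S) :
  f (generic_form a b) = generic_form (f \o a) (f \o b).
Proof.
rewrite /generic_form rmorphM quartic_disc_morph.
congr (_ * quartic_disc _); first by rewrite /= !fE.
apply/funext; rewrite /residual_quartic => k /=.
by case: k => [[|[|[|[|[|k]]]]] klt] //=; rewrite !fE.
Qed.

End Morphism.

Lemma generic_form_neq0 (R : realType) : exists a b : 'rV[R[i]]_6,
  generic_form (a 0) (b 0) != 0.
Proof.
exists (\row_k [:: 1; 0; 1; 0; 1; 1]`_k), (\row_k [:: 0; 1; 1; 1; 1; 1]`_k).
rewrite /generic_form /quartic_disc /residual_quartic !mxE /=.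
(* The discriminants of the curves are both -15, the minor is -1 and the
   discriminant of t^4 + 2 t^3 + 2 t^2 + 3 t + 1 is -491. *)
rewrite (_ : _ * _ = 225 * 491) ?mulf_neq0 ?pnatr_eq0 //.
by ring.
Qed.

End Genericity.

Theorem proposition4p9 (R : realType) :
  for_general (fun c : 'rV[R[i]]_(6 + 6) =>
    let a := lsubmx c in
    let b := rsubmx c in
    exists P : wprojS R,
      [set x | quarter_point a b x] = [set P] /\
      exists C1 C2 : set (wprojS R),
        [/\ irreducible_curve C1, irreducible_curve C2 & C1 <> C2] /\
        [/\ one_dimensional_part (fixed_locus a b) = C1 `|` C2,
            C1 `&` C2 = [set P] &
            (isolated (fixed_locus a b) #= `I_4)%card]).
Proof.
pose F : {mpoly R[i][6 + 6]} :=
  generic_form (fun k => 'X_(lshift 6 k)) (fun k => 'X_(rshift 6 k)).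
have FE (c : 'rV[R[i]]_(6 + 6)) :
    F.@[c 0] = generic_form (lsubmx c 0) (rsubmx c 0).
  rewrite /F (generic_form_morph (meval (c 0))).
  by congr generic_form; apply/funext => k; rewrite /= mevalXU mxE.
exists F => [|c].
  have [a [b ab0]] := generic_form_neq0 R; apply: contra_neq ab0 => F0.
  by have := FE (row_mx a b); rewrite row_mxKl row_mxKr F0 meval0 => <-.
rewrite FE; move: (lsubmx c) (rsubmx c) => a b {F FE c} /=.
have split2 (x y : R[i]) : x * y != 0 -> x != 0 /\ y != 0.
  by rewrite mulf_eq0 negb_or => /andP.
move=> /split2[/split2[/split2[/split2[/split2[aN0 bN0] b03] disc1] disc2]
  disc].
have [/split2[/split2[a0 a2] a4] a5] := split2 _ _ aN0.
have [/split2[/split2[b2 b3] b4] b5] := split2 _ _ bN0.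
have curve1 := @fixed_curve_cofinite R a b false a0 b2 a4 a5 b4 b5 disc1.
have curve2 := @fixed_curve_cofinite R a b true a2 b3 a4 a5 b4 b5 disc2.
have T1 := @wprojS_accessible R.
have C12 := fixed_curvesI a4 a5 b4 b5.
have finC12 : finite_set (fixed_curve a b false `&` fixed_curve a b true).
  by rewrite C12; exact: finite_set1.
have cardF := residual_card a0 a2 a4 b2 b3 b03 disc.
have finF : finite_set (residual_fixed a b) by apply/finite_setP; exists 4%N.
have disjF := residual_disjoint a0 a2 a4 b2 b3.
exists (base_point a b); split; first exact: quarter_points.
exists (fixed_curve a b false), (fixed_curve a b true); rewrite fixed_locusE;
  split.
  split.
  - by split; [exact: cofinite_irreducible | exact: cofinite_has_dim1].
  - by split; [exact: cofinite_irreducible | exact: cofinite_has_dim1].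
  - by move=> E; have [_ inf1 _] := curve1; apply: inf1;
    rewrite -[X in finite_set X]setIid {2}E.
split=> //; first exact: one_dimensional_part_curves.
by rewrite isolated_curves.
Qed.
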